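(* Let $\gamma>\gamma^\star$. Then the set $\mathcal{K}_{\gamma}$ of full-order stabilizing dynamical controllers whose closed-loop transfer function from $w$ to $z$ has $\mathcal{H}_\infty$ norm less than $\gamma$ has at most two path-connected components.
   Context: Consider the continuous-time linear plant $\dot x=Ax+B_1w+B_2u$, $z=C_1x+D_{11}w+D_{12}u$, $y=C_2x+D_{21}w$, with state $x\in\mathbb{R}^{n_x}$, disturbance $w\in\mathbb{R}^{n_w}$, control input $u\in\mathbb{R}^{n_u}$, measured output $y\in\mathbb{R}^{n_y}$, performance output $z\in\mathbb{R}^{n_z}$, and real matrices of compatible dimensions. Assume $(A,B_2)$ is stabilizable and $(C_2,A)$ is detectable. A full-order dynamical controller $\dot\xi=A_K\xi+B_Ky$, $u=C_K\xi+D_Ky$ with $\xi\in\mathbb{R}^{n_x}$ is identified with the matrix $K=\begin{bmatrix}D_K & C_K\\ B_K & A_K\end{bmatrix}\in\mathbb{R}^{(n_u+n_x)\times(n_y+n_x)}$. The closed-loop matrices are $A_{cl}=\begin{bmatrix}A+B_2D_KC_2 & B_2C_K\\ B_KC_2 & A_K\end{bmatrix}$, $B_{cl}=\begin{bmatrix}B_1+B_2D_KD_{21}\\ B_KD_{21}\end{bmatrix}$, $C_{cl}=\begin{bmatrix}C_1+D_{12}D_KC_2 & D_{12}C_K\end{bmatrix}$, $D_{cl}=D_{11}+D_{12}D_KD_{21}$. Let $\mathcal{C}_{stab}$ be the set of all $K$ with $A_{cl}$ Hurwitz, and $\mathbf{T}_{zw}(s)=C_{cl}(sI-A_{cl})^{-1}B_{cl}+D_{cl}$,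 with $\|\mathbf{T}_{zw}\|_\infty=\sup_{\omega\in\mathbb{R}}\sigma_{\max}(\mathbf{T}_{zw}(j\omega))$. For $\gamma>0$, $\mathcal{K}_\gamma=\{K\in\mathcal{C}_{stab}: \|\mathbf{T}_{zw}\|_\infty<\gamma\}$, and $\gamma^\star=\inf_{K\in\mathcal{C}_{stab}}\|\mathbf{T}_{zw}\|_\infty$ (finite under the assumptions). *)

(* Defs.v *)
From HB Require Import structures.
From mathcomp Require Import all_boot all_order all_algebra.
From mathcomp Require Import all_classical all_reals all_analysis.
From mathcomp Require Import complex.
Import Order.TTheory GRing.Theory Num.Theory numFieldNormedType.Exports.

Set Implicit Arguments.
Unset Strict Implicit.
Unset Printing Implicit Defensive.

Local Open Scope classical_set_scope.
Local Open Scope ring_scope.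

Section Hinf.
Variable R : realType.

Definition Cmx (m n : nat) (A : 'M[R]_(m, n)) : 'M[R[i]]_(m, n) :=
  map_mx (fun x : R => x%:C)%C A.

Definition hurwitz (n : nat) (A : 'M[R]_n) : Prop :=
  forall l : R[i], root (char_poly (Cmx A)) l -> complex.Re l < 0.

Definition cvnorm (q : nat) (v : 'cV[R[i]]_q) : R :=
  Num.sqrt (\sum_(i < q) (complex.Re (v i 0) ^+ 2 + complex.Im (v i 0) ^+ 2)).

Definition sigma_max (p q : nat) (M : 'M[R[i]]_(p, q)) : R :=
  sup [set x | exists v : 'cV[R[i]]_q, cvnorm v = 1 /\ x = cvnorm (M *m v)].

Record plant (nx nw nu ny nz : nat) := Plant {
  pA : 'M[R]_(nx, nx);
  pB1 : 'M[R]_(nx, nw);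
  pB2 : 'M[R]_(nx, nu);
  pC1 : 'M[R]_(nz, nx);
  pD11 : 'M[R]_(nz, nw);
  pD12 : 'M[R]_(nz, nu);
  pC2 : 'M[R]_(ny, nx);
  pD21 : 'M[R]_(ny, nw) }.

Variables (nx nw nu ny nz : nat) (P : plant nx nw nu ny nz).

Definition stabilizable : Prop :=
  exists F : 'M[R]_(nu, nx), hurwitz (pA P + pB2 P *m F).
Definition detectable : Prop :=
  exists L : 'M[R]_(nx, ny), hurwitz (pA P + L *m pC2 P).

(* Controller K = [D_K C_K; B_K A_K]. *)
Definition controller := 'M[R]_(nu + nx, ny + nx).

Section CL.
Variable K : controller.
Let DK : 'M[R]_(nu, ny) := ulsubmx K.
Let CK : 'M[R]_(nu, nx) := ursubmx K.
Let BK : 'M[R]_(nx, ny) := dlsubmx K.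
Let AK : 'M[R]_(nx, nx) := drsubmx K.

Definition Acl : 'M[R]_(nx + nx) :=
  block_mx (pA P + pB2 P *m DK *m pC2 P) (pB2 P *m CK) (BK *m pC2 P) AK.
Definition Bcl : 'M[R]_(nx + nx, nw) :=
  col_mx (pB1 P + pB2 P *m DK *m pD21 P) (BK *m pD21 P).
Definition Ccl : 'M[R]_(nz, nx + nx) :=
  row_mx (pC1 P + pD12 P *m DK *m pC2 P) (pD12 P *m CK).
Definition Dcl : 'M[R]_(nz, nw) := pD11 P + pD12 P *m DK *m pD21 P.

Definition Tzw (s : R[i]) : 'M[R[i]]_(nz, nw) :=
  Cmx Ccl *m invmx (s%:M - Cmx Acl) *m Cmx Bcl + Cmx Dcl.

Definition hinf_norm : \bar R :=
  ereal_sup [set (sigma_max (Tzw (Complex 0 w)))%:E | w in [set: R]].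
End CL.

Definition Cstab : set controller := [set K | hurwitz (Acl K)].

Definition Kgamma (g : R) : set controller :=
  [set K | Cstab K /\ (hinf_norm K < g%:E)%E].

Definition gamma_star : \bar R := ereal_inf [set hinf_norm K | K in Cstab].

End Hinf.

Definition path_joined (R : realType) (m n : nat) (S : set 'M[R]_(m, n))
    (a b : 'M[R]_(m, n)) : Prop :=
  exists f : R -> 'M[R]_(m, n),
    {within `[0, 1], continuous f} /\ f 0 = a /\ f 1 = b /\
    (forall t : R, 0 <= t <= 1 -> S (f t)).

Definition at_most_two_path_components (R : realType) (m n : nat)
    (S : set 'M[R]_(m, n)) : Prop :=
  forall a b c, S a -> S b -> S c ->
    path_joined S a b \/ path_joined S a c \/ path_joined S b c.

(* Main.v *)
Require Import Defs.
From HB Require Import structures.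
From mathcomp Require Import all_boot all_order all_algebra.
From mathcomp Require Import all_classical all_reals all_analysis.
From mathcomp Require Import perm spectral complex ring lra.
Import Order.TTheory GRing.Theory Num.Theory numFieldNormedType.Exports.
Set Implicit Arguments.
Unset Strict Implicit.
Unset Printing Implicit Defensive.
Local Open Scope classical_set_scope.
Local Open Scope ring_scope.

(** A controller K belongs to K_g exactly when the closed loop satisfies the
    strict bounded real inequality for some P > 0: the hard half is the
    Kalman-Yakubovich-Popov lemma, obtained here from a theorem of alternatives
    for linear matrix inequalities.  If the inequality has no solution there is
    H >= 0, H <> 0, annihilating the linear part; diagonalising a skew-hermitian
    matrix splits H into rank-one pieces, each carried by one frequency
    (infinity included), and these contradict the frequency-domain bound.

    After a small perturbation the off-diagonal block U of P is invertible.  The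
    change of variables of Scherer, Gahinet and Chilali then turns (K, P) into
    (X, Y, U, Z), where (X, Y, Z) ranges over a convex set, U over GL_n
    independently, and K is a continuous function of (X, Y, U, Z).  Since GL_n(R)
    has two path components, separated by the sign of the determinant, two of
    any three controllers can be joined. *)

(** * Continuity and extrema for matrices *)

(** The obstacle is that the bounded real inequality is bilinear in the controller and [P], so its
    solutions do not form a convex set. A congruence by a matrix containing the first block column
    of the inverse of [P] absorbs every product into [X], [Y] and [Z]. The block [U] then drops out
    of the inequality and serves only to recover [K]: it records the choice of basis for the
    controller state, so GL_n is the only possible source of disconnection.

    On the dual side, [H] plays the role of a second moment matrix of state and input. Splitting it
    by frequency exhibits it as a superposition of sinusoidal responses, on which the frequency
    bound is strict.

    Strict inequalities leave a uniform margin, by compactness of the unit sphere. That margin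
    permits the perturbation of [U] and keeps the supremum over all frequencies strictly below the
    prescribed level. *)

Section EntrywiseContinuity.
Variable R : realType.

Lemma continuous_mx (T : topologicalType) m n (f : T -> 'M[R]_(m, n)) :
  (forall i j, continuous (fun t => f t i j)) -> continuous f.
Proof.
move=> fc x A [P Pn PA].
have : \forall t \near x, forall i : 'I_m, forall j : 'I_n, P i j (f t i j).
  by apply: filter_forall => i; apply: filter_forall => j; apply: fc; exact: Pn.
by apply: filterS => t Pt; apply: PA.
Qed.

Lemma continuous_sum (T : topologicalType) (I : Type) (r : seq I) (f : I -> T -> R) :
  (forall i, continuous (f i)) -> continuous (fun t => \sum_(i <- r) f i t).
Proof.
move=> fc; elim: r => [|i r IH] t.
  rewrite (_ : (fun _ => _) = fun=> 0); first exact: cvg_cst.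
  by apply/funext => u; rewrite big_nil.
rewrite (_ : (fun _ => _) = (fun u => f i u + \sum_(j <- r) f j u)).
  by apply: continuousD; [exact: fc | exact: IH].
by apply/funext => u; rewrite big_cons.
Qed.

Lemma continuous_prod (T : topologicalType) (I : Type) (r : seq I) (f : I -> T -> R) :
  (forall i, continuous (f i)) -> continuous (fun t => \prod_(i <- r) f i t).
Proof.
move=> fc; elim: r => [|i r IH] t.
  rewrite (_ : (fun _ => _) = fun=> 1); first exact: cvg_cst.
  by apply/funext => u; rewrite big_nil.
rewrite (_ : (fun _ => _) = (fun u => f i u * \prod_(j <- r) f j u)).
  by apply: continuousM; [exact: fc | exact: IH].
by apply/funext => u; rewrite big_cons.
Qed.

(** Working entry by entry reduces every matrix operation to sums and products of real functions;
    [continuous_mx] converts back at the end. *)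
Definition entry_cont (T : topologicalType) m n (f : T -> 'M[R]_(m, n)) :=
  forall i j, continuous (fun t => f t i j).

Section Ops.
Variable T : topologicalType.

Lemma entry_cont_cst m n (A : 'M[R]_(m, n)) : entry_cont (fun _ : T => A).
Proof. by move=> i j t; exact: cvg_cst. Qed.

Lemma entry_contD m n (f g : T -> 'M[R]_(m, n)) :
  entry_cont f -> entry_cont g -> entry_cont (fun t => f t + g t).
Proof.
move=> fc gc i j t; rewrite (_ : (fun _ => _) = (fun u => f u i j + g u i j)).
  by apply: continuousD; [exact: fc | exact: gc].
by apply/funext => u; rewrite mxE.
Qed.

Lemma entry_contN m n (f : T -> 'M[R]_(m, n)) :
  entry_cont f -> entry_cont (fun t => - f t).
Proof.
move=> fc i j t; rewrite (_ : (fun _ => _) = (fun u => - f u i j)).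
  by apply: continuousN; exact: fc.
by apply/funext => u; rewrite mxE.
Qed.

Lemma entry_contZ m n (k : T -> R) (f : T -> 'M[R]_(m, n)) :
  continuous k -> entry_cont f -> entry_cont (fun t => k t *: f t).
Proof.
move=> kc fc i j t; rewrite (_ : (fun _ => _) = (fun u => k u * f u i j)).
  by apply: continuousM; [exact: kc | exact: fc].
by apply/funext => u; rewrite mxE.
Qed.

Lemma entry_contM m n p (f : T -> 'M[R]_(m, n)) (g : T -> 'M[R]_(n, p)) :
  entry_cont f -> entry_cont g -> entry_cont (fun t => f t *m g t).
Proof.
move=> fc gc i j t.
rewrite (_ : (fun _ => _) = (fun u => \sum_k f u i k * g u k j)).
  by apply: continuous_sum => k u; apply: continuousM; [exact: fc | exact: gc].
by apply/funext => u; rewrite mxE.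
Qed.

Lemma entry_cont_block m1 m2 n1 n2 (f11 : T -> 'M[R]_(m1, n1))
    (f12 : T -> 'M[R]_(m1, n2)) (f21 : T -> 'M[R]_(m2, n1))
    (f22 : T -> 'M[R]_(m2, n2)) :
  entry_cont f11 -> entry_cont f12 -> entry_cont f21 -> entry_cont f22 ->
  entry_cont (fun t => block_mx (f11 t) (f12 t) (f21 t) (f22 t)).
Proof.
move=> c11 c12 c21 c22 i j t.
case: (splitP i) => i' Ei; case: (splitP j) => j' Ej.
- have -> : i = lshift m2 i' by exact: val_inj.
  have -> : j = lshift n2 j' by exact: val_inj.
  by under eq_fun do rewrite block_mxEul; exact: c11.
- have -> : i = lshift m2 i' by exact: val_inj.
  have -> : j = rshift n1 j' by exact: val_inj.
  by under eq_fun do rewrite block_mxEur; exact: c12.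
- have -> : i = rshift m1 i' by exact: val_inj.
  have -> : j = lshift n2 j' by exact: val_inj.
  by under eq_fun do rewrite block_mxEdl; exact: c21.
- have -> : i = rshift m1 i' by exact: val_inj.
  have -> : j = rshift n1 j' by exact: val_inj.
  by under eq_fun do rewrite block_mxEdr; exact: c22.
Qed.

Lemma continuous_det n (f : T -> 'M[R]_n) :
  entry_cont f -> continuous (fun t => \det (f t)).
Proof.
move=> fc; pose F (s : {perm 'I_n}) t : R := (-1) ^+ s * \prod_i f t i (s i).
rewrite (_ : (fun t => _) = (fun t => \sum_s F s t)) //.
apply: continuous_sum => s t.
apply: (@continuousM R _ (fun=> (-1) ^+ s)); first exact: cvg_cst.
by apply: continuous_prod => i; exact: fc.
Qed.

Lemma entry_cont_adj n (f : T -> 'M[R]_n) :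
  entry_cont f -> entry_cont (fun t => \adj (f t)).
Proof.
move=> fc i j t; pose g u : R := \det (row' j (col' i (f u))).
rewrite (_ : (fun _ => _) = (fun u => (-1) ^+ (j + i) * g u)); last first.
  by apply/funext => u; rewrite mxE.
apply: (@continuousM R _ (fun=> (-1) ^+ (j + i)) g); first exact: cvg_cst.
apply: continuous_det => k l u; under eq_fun do rewrite !mxE.
exact: fc.
Qed.

(** Cramer's rule; invertibility at every [t] keeps [invmx] on the branch given by the adjugate. *)
Lemma entry_contV n (f : T -> 'M[R]_n) :
  (forall t, f t \in unitmx) -> entry_cont f -> entry_cont (fun t => invmx (f t)).
Proof.
move=> fu fc i j t.
pose d u : R := \det (f u); pose g u : R := \adj (f u) i j.
rewrite (_ : (fun _ => _) = (fun u => (d u)^-1 * g u)).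
  apply: (@continuousM R _ (fun u => (d u)^-1) g); last exact: entry_cont_adj.
  apply: (@continuousV R _ d); last exact: continuous_det.
  by rewrite /d -unitfE -unitmxE.
by apply/funext => u; rewrite /invmx fu mxE.
Qed.

End Ops.

Lemma entry_cont_id m n : entry_cont (fun M : 'M[R]_(m, n) => M).
Proof. by move=> i j; exact: coord_continuous. Qed.

Lemma mx_EVT_min m n (S : set 'M[R]_(m, n)) (f : 'M[R]_(m, n) -> R) (B : R) :
  S !=set0 -> closed S -> (forall M, S M -> forall i j, `|M i j| <= B) ->
  continuous f -> exists2 c, S c & forall M, S M -> f c <= f M.
Proof.
move=> [M0 SM0] Sc SB fc.
have vc : continuous (@vec_mx R m n).
  apply: continuous_mx => i j t; under eq_fun do rewrite mxE.
  exact: coord_continuous.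
pose S' := [set v : 'rV[R]_(m * n) | S (vec_mx v)].
have S'c : closed S' by apply: (closed_comp (f := @vec_mx R m n)).
have S'b : bounded_set S'.
  exists (Num.max B 0); split; first exact: num_real.
  move=> x; rewrite gt_max => /andP[Bx x0] v Sv /=.
  rewrite (_ : `|v| = mx_norm v) // mx_normrE.
  apply: bigmax_le => [|[i j] _ /=]; first exact: ltW.
  case/mxvec_indexP: j => k l.
  have -> : i = 0 by apply: ord1.
  have := SB _ Sv k l; rewrite mxE => /le_trans; apply; exact: ltW.
have [||c Sc' cm] := EVT_min_rV (f := f \o vec_mx) _ (bounded_closed_compact S'b S'c).
- by exists (mxvec M0); rewrite /S' /= mxvecK.
- by apply: continuous_subspaceT => v; apply: continuous_comp; [exact: vc|exact: fc].
exists (vec_mx c); first by rewrite inE in Sc'.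
by move=> M SM; have := cm (mxvec M); rewrite /= mxvecK; apply; rewrite inE /S' /= mxvecK.
Qed.

End EntrywiseContinuity.

(** * Quadratic forms *)

Section Forms.
Variable R : realType.

Definition dotv n (x y : 'cV[R]_n) : R := \sum_i x i 0 * y i 0.

Lemma dotvC n (x y : 'cV[R]_n) : dotv x y = dotv y x.
Proof. by apply: eq_bigr => i _; rewrite mulrC. Qed.

Lemma dotvDr n (x y z : 'cV[R]_n) : dotv x (y + z) = dotv x y + dotv x z.
Proof. by rewrite -big_split; apply: eq_bigr => i _; rewrite mxE mulrDr. Qed.

Lemma dotvDl n (x y z : 'cV[R]_n) : dotv (y + z) x = dotv y x + dotv z x.
Proof. by rewrite !(dotvC _ x) dotvDr. Qed.

Lemma dotvZr n c (x y : 'cV[R]_n) : dotv x (c *: y) = c * dotv x y.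
Proof. by rewrite mulr_sumr; apply: eq_bigr => i _; rewrite mxE mulrCA. Qed.

Lemma dotvZl n c (x y : 'cV[R]_n) : dotv (c *: x) y = c * dotv x y.
Proof. by rewrite dotvC dotvZr dotvC. Qed.

Lemma dotvNr n (x y : 'cV[R]_n) : dotv x (- y) = - dotv x y.
Proof. by rewrite -scaleN1r dotvZr mulN1r. Qed.

Lemma dotvNl n (x y : 'cV[R]_n) : dotv (- x) y = - dotv x y.
Proof. by rewrite dotvC dotvNr dotvC. Qed.

Lemma dotv0r n (x : 'cV[R]_n) : dotv x 0 = 0.
Proof. by rewrite /dotv big1 // => i _; rewrite mxE mulr0. Qed.

Lemma dotv0l n (x : 'cV[R]_n) : dotv 0 x = 0.
Proof. by rewrite dotvC dotv0r. Qed.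

Definition dotvE := (dotvDr, dotvDl, dotvZr, dotvZl, dotvNr, dotvNl).

Lemma dotv_mulmxr m n (A : 'M[R]_(m, n)) x y :
  dotv x (A *m y) = dotv (A^T *m x) y.
Proof.
rewrite /dotv; under eq_bigr do rewrite mxE mulr_sumr.
rewrite exchange_big; apply: eq_bigr => j _; rewrite mxE mulr_suml.
by apply: eq_bigr => i _; rewrite mxE; ring.
Qed.

Lemma dotv_mulmxl m n (A : 'M[R]_(m, n)) x y :
  dotv (A *m x) y = dotv x (A^T *m y).
Proof. by rewrite dotvC dotv_mulmxr dotvC. Qed.

Lemma dotv_ge0 n (x : 'cV[R]_n) : 0 <= dotv x x.
Proof. by apply: sumr_ge0 => i _; rewrite -expr2 sqr_ge0. Qed.

Lemma dotv_eq0 n (x : 'cV[R]_n) : dotv x x = 0 -> x = 0.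
Proof.
move=> x0; apply/matrixP => i j; rewrite (ord1 j) mxE; apply/eqP.
rewrite -sqrf_eq0 expr2.
have /eqP := x0; rewrite psumr_eq0 => [/allP/(_ i)|k _]; last first.
  by rewrite -expr2 sqr_ge0.
by apply; rewrite mem_index_enum.
Qed.

Lemma dotv_gt0 n (x : 'cV[R]_n) : x != 0 -> 0 < dotv x x.
Proof.
by move=> x0; rewrite lt0r dotv_ge0 andbT; apply: contra x0 => /eqP/dotv_eq0 ->.
Qed.

Lemma dotv_col m n (a c : 'cV[R]_m) (b d : 'cV[R]_n) :
  dotv (col_mx a b) (col_mx c d) = dotv a c + dotv b d.
Proof.
rewrite /dotv big_split_ord /=.
by congr (_ + _); apply: eq_bigr => i _; rewrite ?col_mxEu ?col_mxEd.
Qed.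

Lemma mxtrace_rank1 n (x y : 'cV[R]_n) (M : 'M[R]_n) :
  \tr (x *m y^T *m M) = dotv y (M *m x).
Proof.
rewrite -mulmxA mxtrace_mulC trace_mx11 -mulmxA mxE.
by apply: eq_bigr => i _; rewrite mxE.
Qed.

(* No symmetry is required: only the quadratic form of [M] matters. *)
Definition posdef n (M : 'M[R]_n) :=
  forall x : 'cV[R]_n, x != 0 -> 0 < dotv x (M *m x).

Definition psd n (M : 'M[R]_n) :=
  M^T = M /\ forall x : 'cV[R]_n, 0 <= dotv x (M *m x).

Lemma posdef_unit n (M : 'M[R]_n) : posdef M -> M \in unitmx.
Proof.
move=> Mp; rewrite -unitmx_tr -row_free_unit -kermx_eq0; apply/eqP/row_matrixP.
move=> i; rewrite row0; apply/eqP/negP => /negP r0.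
have := Mp (row i (kermx M^T))^T; rewrite trmx_eq0 => /(_ r0).
by rewrite -[M in M *m _]trmxK -trmx_mul -row_mul mulmx_ker row0 trmx0 dotv0r ltxx.
Qed.

Lemma posdefZ n c (M : 'M[R]_n) : 0 < c -> posdef M -> posdef (c *: M).
Proof. by move=> c0 Mp x x0; rewrite -scalemxAl dotvZr mulr_gt0 // Mp. Qed.

Lemma dotv_delta n (i : 'I_n) (x : 'cV[R]_n) : dotv (delta_mx i 0) x = x i 0.
Proof.
rewrite /dotv (bigD1 i) //= big1 => [|j ji]; rewrite mxE ?eqxx ?mul1r ?addr0 //.
by rewrite (negPf ji) mul0r.
Qed.

Lemma dotv_deltaM n (i j : 'I_n) (M : 'M[R]_n) :
  dotv (delta_mx i 0) (M *m delta_mx j 0) = M i j.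
Proof. by rewrite dotv_delta -colE mxE. Qed.

Lemma dotv_form_bound n (M : 'M[R]_n) :
  exists2 c, 0 < c & forall x, `|dotv x (M *m x)| <= c * dotv x x.
Proof.
exists (1 + \sum_i \sum_j `|M i j|) => [|x].
  rewrite ltr_wpDr // sumr_ge0 // => i _; exact: sumr_ge0.
have E : dotv x (M *m x) = \sum_i \sum_j M i j * (x i 0 * x j 0).
  apply: eq_bigr => i _; rewrite mxE mulr_sumr; apply: eq_bigr => j _; ring.
have xi (i : 'I_n) : x i 0 ^+ 2 <= dotv x x.
  rewrite /dotv (bigD1 i) //= -expr2 lerDl sumr_ge0 // => k _.
  by rewrite -expr2 sqr_ge0.
rewrite E mulrDl mul1r ler_wpDl ?dotv_ge0 //.
apply: le_trans (ler_norm_sum _ _ _) _; rewrite mulr_suml; apply: ler_sum => i _.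
apply: le_trans (ler_norm_sum _ _ _) _; rewrite mulr_suml; apply: ler_sum => j _.
rewrite normrM ler_wpM2l // ler_norml.
have := xi i; have := xi j; have := sqr_ge0 (x i 0 + x j 0).
have := sqr_ge0 (x i 0 - x j 0); rewrite !expr2.
by move: (dotv x x) => d; move=> *; apply/andP; split; nra.
Qed.

Lemma dotv_mulmx_bound m n (M : 'M[R]_(m, n)) :
  exists2 c, 0 < c & forall x, dotv (M *m x) (M *m x) <= c * dotv x x.
Proof.
have [c c0 cP] := dotv_form_bound (M^T *m M); exists c => // x.
by rewrite dotv_mulmxl mulmxA; apply: le_trans (cP x); exact: ler_norm.
Qed.

Lemma continuous_dotv (T : topologicalType) n (f g : T -> 'cV[R]_n) :
  entry_cont f -> entry_cont g -> continuous (fun t => dotv (f t) (g t)).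
Proof.
move=> fc gc; rewrite /dotv.
pose F i t : R := f t i 0 * g t i 0.
rewrite (_ : (fun t => _) = (fun t => \sum_i F i t)) //.
by apply: continuous_sum => i t; apply: (@continuousM R _ (fun u => f u i 0));
  [exact: fc | exact: gc].
Qed.

Lemma closed_sphere n : closed [set x : 'cV[R]_n | dotv x x = 1].
Proof.
have := @closed_comp _ _ (fun x : 'cV[R]_n => dotv x x) [set 1].
apply; last exact: closed_eq.
by move=> x _; apply: continuous_dotv; exact: entry_cont_id.
Qed.

Lemma sphere_bound n (x : 'cV[R]_n) : dotv x x = 1 -> forall i j, `|x i j| <= 1.
Proof.
move=> x1 i j; rewrite (ord1 j) -(@ler_pXn2r _ 2) ?nnegrE // expr1n real_normK
  ?num_real //.
rewrite -x1 /dotv (bigD1 i) //= -expr2 lerDl sumr_ge0 // => k _.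
by rewrite -expr2 sqr_ge0.
Qed.

Lemma exists_unit_direction n (x : 'cV[R]_n) : x != 0 ->
  exists2 y, dotv y y = 1 & exists2 c, c != 0 & x = c *: y.
Proof.
move=> x0; have d0 := dotv_gt0 x0.
have s0 : Num.sqrt (dotv x x) != 0 by rewrite gt_eqF // sqrtr_gt0.
exists ((Num.sqrt (dotv x x))^-1 *: x); last first.
  by exists (Num.sqrt (dotv x x)) => //; rewrite scalerA divff // scale1r.
rewrite dotvZl dotvZr mulrA -invfM -expr2 sqr_sqrtr ?ltW // mulVf //.
by rewrite gt_eqF.
Qed.

Lemma posdef_gap n (M : 'M[R]_n) : posdef M ->
  exists2 d, 0 < d & forall x, d * dotv x x <= dotv x (M *m x).
Proof.
(* The unit sphere is empty only in dimension 0, where any gap works. *)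
move=> Mp; have [S0|/set0P S0] := eqVneq [set x : 'cV[R]_n | dotv x x = 1] set0.
  exists 1 => // x; have [->|x0] := eqVneq x 0; first by rewrite mulmx0 !dotv0r mulr0.
  have [y y1 _] := exists_unit_direction x0.
  by have : [set x : 'cV[R]_n | dotv x x = 1] y by []; rewrite S0.
have [||c c1 cm] := mx_EVT_min S0 (closed_sphere (n := n))
  (f := fun x => dotv x (M *m x)) (B := 1).
- exact: sphere_bound.
- apply: continuous_dotv; first exact: entry_cont_id.
  by apply: entry_contM; [exact: entry_cont_cst | exact: entry_cont_id].
have c0 : c != 0 by apply/eqP => c0; move: c1 => /=; rewrite c0 dotv0r => /esym/eqP;
  rewrite oner_eq0.
exists (dotv c (M *m c)); first exact: Mp.
move=> x; have [->|/exists_unit_direction[y y1 [k _ ->]]] := eqVneq x 0.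
  by rewrite mulmx0 !dotv0r mulr0.
rewrite -scalemxAr !dotvE y1 mulr1 mulrC mulrA -expr2 ler_wpM2l ?sqr_ge0 //.
exact: cm.
Qed.

Lemma posdef_perturb n (M N : 'M[R]_n) : posdef M ->
  exists2 e, 0 < e & forall t, 0 <= t <= e -> posdef (M + t *: N).
Proof.
move=> /posdef_gap[d d0 dP]; have [c c0 cP] := dotv_form_bound N.
(* Up to this value of [t] the perturbation consumes at most half of the gap [d]. *)
exists (d / (2 * c)) => [|t /andP[t0 te] x x0]; first by rewrite divr_gt0 // mulr_gt0.
rewrite mulmxDl -scalemxAl dotvE dotvZr.
have := cP x; rewrite ler_norml => /andP[Nl _]; have := dP x; have := dotv_gt0 x0.
move: te; rewrite ler_pdivlMr ?mulr_gt0 //.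
move: (dotv x x) (dotv x (M *m x)) (dotv x (N *m x)) Nl => a b f Nl te a0 ba.
have : t * - (c * a) <= t * f by apply: ler_wpM2l.
nra.
Qed.

(** A step from [x] along - H x changes the form at first order by a negative multiple of |H x|^2,
    so it would become negative. In the step length, [a + 1] replaces [a], which may be 0. *)
Lemma psd_ker n (H : 'M[R]_n) x : psd H -> dotv x (H *m x) = 0 -> H *m x = 0.
Proof.
move=> [Hs Hp] x0; apply: dotv_eq0; set y := H *m x.
apply/eqP; rewrite eq_le dotv_ge0 andbT leNgt; apply/negP => b0.
pose a := dotv y (H *m y).
have a0 : 0 <= a by exact: Hp.
have := Hp (x - (dotv y y / (a + 1)) *: y).
have xy : dotv x (H *m y) = dotv y y by rewrite dotv_mulmxr Hs.
rewrite mulmxBr -scalemxAr !dotvE x0 xy -/y -/a.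
move: (dotv y y) b0 => b b0; rewrite leNgt => /negP; apply.
rewrite [ltLHS](_ : _ = - (b / (a + 1)) * ((b / (a + 1)) * (a + 2))).
  by rewrite mulNr oppr_lt0 !mulr_gt0 ?invr_gt0 //; lra.
by field; rewrite gt_eqF //; lra.
Qed.

End Forms.

(** * A theorem of alternatives for linear matrix inequalities *)

Section Alternative.
Variable R : realType.

Lemma psd_diag_ge0 n (H : 'M[R]_n) i : psd H -> 0 <= H i i.
Proof. by case=> _ /(_ (delta_mx i 0)); rewrite dotv_deltaM. Qed.

(** Nonnegativity at e_i + e_j and e_i - e_j bounds 2 |H_ij| by H_ii + H_jj. This makes the
    trace-one psd matrices a bounded set. *)
Lemma psd_entry_bound n (H : 'M[R]_n) i j : psd H -> `|H i j| <= \tr H.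
Proof.
move=> Hp; have [Hs Hq] := Hp.
have tr_ge k : H k k <= \tr H.
  rewrite /mxtrace (bigD1 k) //= lerDl sumr_ge0 // => l _; exact: psd_diag_ge0.
have Hji : H j i = H i j by rewrite -[H in LHS]Hs mxE.
have := Hq (delta_mx i 0 + delta_mx j 0); have := Hq (delta_mx i 0 - delta_mx j 0).
rewrite mulmxBr mulmxDr !dotvE !dotv_deltaM Hji => h1 h2.
have := tr_ge i; have := tr_ge j; rewrite ler_norml.
by move: h1 h2; move: (\tr H) => t *; apply/andP; split; lra.
Qed.

Lemma psd_comb n (H K : 'M[R]_n) t : 0 <= t <= 1 -> psd H -> psd K ->
  psd ((1 - t) *: H + t *: K).
Proof.
move=> /andP[t0 t1] [Hs Hp] [Ks Kp]; split.
  by rewrite linearD !linearZ /= Hs Ks.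
move=> x; rewrite mulmxDl -!scalemxAl !dotvE.
by rewrite addr_ge0 // mulr_ge0 // subr_ge0.
Qed.

Lemma psd_rank1 n (x : 'cV[R]_n) c : 0 <= c -> psd (c *: (x *m x^T)).
Proof.
move=> c0; split; first by rewrite linearZ /= trmx_mul trmxK.
move=> y; rewrite -scalemxAl dotvZr mulr_ge0 // -mulmxA.
rewrite [x^T *m y]mx11_scalar mul_mx_scalar dotvZr.
rewrite (_ : (x^T *m y) 0 0 = dotv y x) -?expr2 ?sqr_ge0 // mxE dotvC.
by apply: eq_bigr => k _; rewrite mxE.
Qed.

Lemma first_order_ge0 (b c : R) :
  (forall t, 0 < t <= 1 -> 0 <= t * b + t ^+ 2 * c) -> 0 <= b.
Proof.
move=> h; rewrite leNgt; apply/negP => b0.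
(* This choice gives t <= 1 and t |c| < - b, so the linear term wins. *)
pose t := - b / (- b + `|c| + 1).
have D0 : 0 < - b + `|c| + 1 by have := normr_ge0 c; lra.
have t0 : 0 < t by rewrite divr_gt0 // oppr_gt0.
have t1 : t <= 1 by rewrite ler_pdivrMr // mul1r; have := normr_ge0 c; lra.
have := h t; rewrite t0 t1 => /(_ isT).
rewrite expr2 -mulrA -mulrDr pmulr_rge0 // leNgt => /negP; apply.
have tc : t * `|c| < - b.
  rewrite mulrC mulrA ltr_pdivrMr // mulrC ltr_pM2l ?oppr_gt0 //; lra.
have := ler_norm c => /(ler_wpM2l (ltW t0)); lra.
Qed.

(* [phi] measures how far [H] is from satisfying the second alternative.  If its
   minimum over the trace-one psd matrices is positive, the first-order condition
   at the minimiser, tested on the matrices [x x^T / |x|^2], yields a solution. *)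
Lemma lmi_alternative m (I : finType) (M : I -> 'M[R]_m) (N : 'M[R]_m) :
  (exists z : I -> R, posdef (\sum_i z i *: M i + N)) \/
  (exists H, [/\ psd H, H != 0, (forall i, \tr (H *m M i) = 0) &
              \tr (H *m N) <= 0]).
Proof.
pose D := [set H : 'M[R]_m | psd H /\ \tr H = 1].
pose phi (H : 'M[R]_m) : R := \sum_i \tr (H *m M i) ^+ 2 + Num.max 0 (\tr (H *m N)) ^+ 2.
have tr_cont (A : 'M[R]_m) : continuous (fun H : 'M[R]_m => \tr (H *m A)).
  pose F i (H : 'M[R]_m) : R := (H *m A) i i.
  rewrite (_ : (fun H => _) = (fun H => \sum_i F i H)) //.
  apply: continuous_sum => i; apply: entry_contM; first exact: entry_cont_id.
  exact: entry_cont_cst.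
have sqr_cont (f : 'M[R]_m -> R) : continuous f -> continuous (fun H => f H ^+ 2).
  move=> fc H; rewrite (_ : (fun _ => _) = (fun H => f H * f H)).
    by apply: (@continuousM R _ f f); exact: fc.
  by apply/funext => K; rewrite expr2.
have phi_cont : continuous phi.
  pose F i (H : 'M[R]_m) : R := \tr (H *m M i) ^+ 2.
  pose g (H : 'M[R]_m) : R := Num.max 0 (\tr (H *m N)) ^+ 2.
  pose G (H : 'M[R]_m) : R := \sum_i F i H.
  rewrite (_ : phi = fun H => G H + g H) // => H.
  apply: (@continuousD R _ _ G g).
    move: H; apply: (@continuous_sum _ _ _ _ F) => i H.
    by apply: (sqr_cont (fun H => \tr (H *m M i))); exact: tr_cont.
  apply: sqr_cont => {}H.
  apply: (@continuous_max R _ (fun=> 0) (fun H : 'M[R]_m => \tr (H *m N))).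
    exact: cst_continuous.
  exact: tr_cont.
have Dcl : closed D.
  rewrite (_ : D =
      \bigcap_(p in [set: 'I_m * 'I_m])
         [set H : 'M[R]_m | H p.1 p.2 - H p.2 p.1 = 0] `&`
      \bigcap_(x in [set: 'cV[R]_m]) [set H : 'M[R]_m | 0 <= dotv x (H *m x)] `&`
      [set H | \tr (H *m 1%:M) = 1]); last first.
    apply/seteqP; split => [H [[Hs Hp] Ht]|H [[Hs Hp] Ht]].
      split; last by rewrite /= mulmx1 Ht.
      split => [[i j] _|x _]; last exact: Hp.
      by rewrite /= -[H in X in _ - X]Hs mxE subrr.
    split; last by move: Ht; rewrite /= mulmx1.
    split; last by move=> x; exact: Hp.
    apply/matrixP => i j; rewrite mxE; apply/esym/eqP; rewrite -subr_eq0.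
    by have := Hs (i, j) Logic.I => /= ->.
  apply: closedI; first apply: closedI.
  - apply: closed_bigI => -[i j] _.
    apply: (@closed_comp _ _ (fun H : 'M[R]_m => H i j - H j i) [set 0]).
      by move=> H _; apply: (@continuousB R _ _ (fun H : 'M[R]_m => H i j));
        exact: coord_continuous.
    exact: closed_eq.
  - apply: closed_bigI => x _.
    apply: (@closed_comp _ _ (fun H : 'M[R]_m => dotv x (H *m x)) [set r | 0 <= r]).
      move=> H _; apply: continuous_dotv; first exact: entry_cont_cst.
      by apply: entry_contM; [exact: entry_cont_id|exact: entry_cont_cst].
    exact: closed_ge.
  - apply: (@closed_comp _ _ (fun H : 'M[R]_m => \tr (H *m 1%:M)) [set 1]).
      by move=> H _; exact: tr_cont.
    exact: closed_eq.
(* In dimension 0 no matrix has trace one, but positive definiteness is vacuous. *)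
have [m0|m0] := posnP m.
  left; exists (fun=> 0) => x; subst m.
  by rewrite (_ : x = 0) ?eqxx //; apply/matrixP => -[].
have Dne : D !=set0.
  pose i0 := Ordinal m0; pose e : 'cV[R]_m := delta_mx i0 0; exists (1 *: (e *m e^T));
    split.
    exact: psd_rank1.
  by rewrite scale1r -[X in \tr X]mulmx1 mxtrace_rank1 mul1mx dotv_delta mxE !eqxx.
have [H0 [H0p H0t] H0m] : exists2 c, D c & forall H, D H -> phi c <= phi H.
  apply: (mx_EVT_min (B := 1)) => // H [Hp Ht] i j.
  by rewrite -Ht; exact: psd_entry_bound.
pose a i := \tr (H0 *m M i); pose s := Num.max 0 (\tr (H0 *m N)).
have s0 : 0 <= s by rewrite le_max lexx.
have phi_ge0 H : 0 <= phi H.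
  by rewrite addr_ge0 ?sqr_ge0 // sumr_ge0 // => i _; rewrite sqr_ge0.
have [phi0|phi0] := eqVneq (phi H0) 0.
  right; exists H0; move/eqP: phi0; rewrite paddr_eq0 ?sqr_ge0 //; last first.
    by rewrite sumr_ge0 // => i _; rewrite sqr_ge0.
  rewrite sqrf_eq0 psumr_eq0 => [/andP[/allP ai /eqP sE]|i _]; last exact: sqr_ge0.
  split => //.
  - by apply/eqP => H00; move/eqP: H0t; rewrite H00 mxtrace0 eq_sym oner_eq0.
  - by move=> i; apply/eqP; rewrite -sqrf_eq0; apply: ai; rewrite mem_index_enum.
  - by rewrite -sE le_max lexx orbT.
left; have {}phi0 : 0 < phi H0 by rewrite lt0r phi0 phi_ge0.
(* Half the derivative of [phi] at [H0] towards [K] is this sum minus [phi H0], so minimality bounds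
   the sum below by [phi H0]. *)
have key K : D K -> 0 < \sum_i a i * \tr (K *m M i) + s * \tr (K *m N).
  move=> [Kp Kt]; pose k i := \tr (K *m M i); pose kN := \tr (K *m N).
  apply: lt_le_trans phi0 _; rewrite -subr_ge0.
  apply: (@first_order_ge0 _ ((\sum_i (k i - a i) ^+ 2 + (kN - s) ^+ 2) / 2)).
  move=> t /andP[t0 t1].
  have /H0m : D ((1 - t) *: H0 + t *: K).
    split; first by apply: psd_comb; rewrite // (ltW t0).
    by rewrite mxtraceD !mxtraceZ H0t Kt; ring.
  have trC A : \tr (((1 - t) *: H0 + t *: K) *m A) =
    (1 - t) * \tr (H0 *m A) + t * \tr (K *m A).
    by rewrite mulmxDl -!scalemxAl mxtraceD !mxtraceZ.
  rewrite {2}/phi trC; under [X in _ <= X + _]eq_bigr do rewrite trC -/(a _) -/(k _).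
  (* The positive part is not polynomial in [t]. Its square is dominated by that of the affine
     function from [s] to [kN], with equality at t = 0, which is all that the first-order condition
     needs. *)
  have mx : Num.max 0 ((1 - t) * \tr (H0 *m N) + t * \tr (K *m N)) ^+ 2 <=
            ((1 - t) * s + t * kN) ^+ 2.
    rewrite -[leRHS]real_normK ?num_real // lerXn2r ?nnegrE ?le_max ?lexx //.
    rewrite ge_max normr_ge0 /=; apply: le_trans (ler_norm _).
    by rewrite lerD2r ler_wpM2l ?subr_ge0 // le_max lexx orbT.
  move=> /le_trans/(_ (lerD (lexx _) mx)).
  rewrite /phi -/s; under [X in X + _ <= _]eq_bigr do rewrite -/(a _).
  have -> : \sum_i ((1 - t) * a i + t * k i) ^+ 2 = \sum_i a i ^+ 2 +
     2 * t * (\sum_i a i * k i - \sum_i a i ^+ 2) + t ^+ 2 * \sum_i (k i - a i) ^+ 2.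
    rewrite -sumrB !mulr_sumr -!big_split /=; apply: eq_bigr => i _; ring.
  move: (\sum_i a i ^+ 2) (\sum_i a i * k i) (\sum_i (k i - a i) ^+ 2) => x y z h.
  rewrite -(@pmulr_rge0 _ 2) //; rewrite -subr_ge0 in h.
  by apply: le_trans h _; rewrite le_eqVlt; apply/orP; left; apply/eqP; field.
have pd : posdef (\sum_i a i *: M i + s *: N).
  move=> x x0; have x1 := dotv_gt0 x0.
  have /key : D ((dotv x x)^-1 *: (x *m x^T)).
    split; first by apply: psd_rank1; rewrite invr_ge0 ltW.
    by rewrite mxtraceZ -[X in \tr X]mulmx1 mxtrace_rank1 mul1mx mulVf // gt_eqF.
  have trx A : \tr ((dotv x x)^-1 *: (x *m x^T) *m A) = (dotv x x)^-1 * dotv x (A *m x).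
    by rewrite -scalemxAl mxtraceZ mxtrace_rank1.
  rewrite trx; under eq_bigr do rewrite trx mulrCA.
  rewrite -mulr_sumr mulrCA -mulrDr pmulr_rgt0 ?invr_gt0 //.
  rewrite mulmxDl -scalemxAl dotvDr dotvZr mulmx_suml.
  congr (_ < _ + _); rewrite (big_morph (dotv x) (dotvDr x) (dotv0r x)).
  by apply: eq_bigr => i _; rewrite -scalemxAl dotvZr.
(* The coefficient of [N] has to become 1: divide by [s] if it is positive; if it is 0, openness
   allows adding a small multiple of [N] before dividing. *)
move: s0; rewrite le_eqVlt => /predU1P[s0|s0].
  move: pd; rewrite -s0 scale0r addr0 => /(posdef_perturb N)[e e0].
  move=> /(_ e); rewrite lexx ltW // => /(_ isT).
  have e0' : 0 < e^-1 by rewrite invr_gt0.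
  move=> /(posdefZ e0'); rewrite scalerDr scalerA mulVf ?gt_eqF // scale1r.
  rewrite scaler_sumr => h; exists (fun i => e^-1 * a i).
  by under eq_bigr do rewrite -scalerA.
have s0' : 0 < s^-1 by rewrite invr_gt0.
move/(posdefZ s0'): pd; rewrite scalerDr scalerA mulVf ?gt_eqF // scale1r.
rewrite scaler_sumr => h; exists (fun i => s^-1 * a i).
by under eq_bigr do rewrite -scalerA.
Qed.

End Alternative.

(** * Complex matrices as pairs of real ones *)

Section Complexification.
Variable R : realType.

Definition cx m n (a b : 'M[R]_(m, n)) : 'M[R[i]]_(m, n) :=
  \matrix_(i, j) Complex (a i j) (b i j).

Lemma cxE m n (M : 'M[R[i]]_(m, n)) :
  M = cx (map_mx (@complex.Re R) M) (map_mx (@complex.Im R) M).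
Proof. by apply/matrixP => i j; rewrite !mxE; case: (M i j). Qed.

Lemma cx_inj m n (a b c d : 'M[R]_(m, n)) : cx a b = cx c d -> a = c /\ b = d.
Proof.
move=> /matrixP E; split; apply/matrixP => i j; have := E i j; rewrite !mxE => -[] //.
Qed.

Lemma cx0 m n : cx 0 0 = 0 :> 'M[R[i]]_(m, n).
Proof. by apply/matrixP => i j; rewrite !mxE. Qed.

Lemma cx_eq0 m n (a b : 'M[R]_(m, n)) : cx a b != 0 -> (a != 0) \/ (b != 0).
Proof.
move=> ab; have [a0|] := eqVneq a 0; last by left.
by right; apply: contra ab => /eqP ->; rewrite a0 cx0.
Qed.

Lemma sum_Complex (I : Type) (r : seq I) (P : pred I) (f g : I -> R) :
  \sum_(i <- r | P i) Complex (f i) (g i) =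
  Complex (\sum_(i <- r | P i) f i) (\sum_(i <- r | P i) g i).
Proof. by elim/big_rec3: _ => // i x y z _ ->. Qed.

Lemma CmxM m n p (A : 'M[R]_(m, n)) (B : 'M[R]_(n, p)) :
  Cmx (A *m B) = Cmx A *m Cmx B.
Proof. exact: map_mxM. Qed.

Lemma CmxT m n (A : 'M[R]_(m, n)) : Cmx A^T = (Cmx A)^T.
Proof. by apply/matrixP => i j; rewrite !mxE. Qed.

Lemma Cmx_cx m n p (A : 'M[R]_(m, n)) (a b : 'M[R]_(n, p)) :
  Cmx A *m cx a b = cx (A *m a) (A *m b).
Proof.
apply/matrixP => i j; rewrite !mxE -sum_Complex; apply: eq_bigr => k _.
by rewrite !mxE; apply/eqP; rewrite eq_complex /=; apply/andP; split; apply/eqP; ring.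
Qed.

Lemma cxD m n (a b c d : 'M[R]_(m, n)) : cx a b + cx c d = cx (a + c) (b + d).
Proof. by apply/matrixP => i j; rewrite !mxE. Qed.

Lemma cxN m n (a b : 'M[R]_(m, n)) : - cx a b = cx (- a) (- b).
Proof. by apply/matrixP => i j; rewrite !mxE. Qed.

Lemma cxZ m n (u v : R) (a b : 'M[R]_(m, n)) :
  Complex u v *: cx a b = cx (u *: a - v *: b) (u *: b + v *: a).
Proof. by apply/matrixP => i j; rewrite !mxE; apply/eqP; rewrite eq_complex /= !eqxx. Qed.

Lemma cvnorm_cx n (a b : 'cV[R]_n) : cvnorm (cx a b) = Num.sqrt (dotv a a + dotv b b).
Proof.
rewrite /cvnorm /dotv -big_split; congr Num.sqrt.
by apply: eq_bigr => i _; rewrite !mxE /= !expr2.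
Qed.

Lemma nonunit_ker (F : fieldType) n (M : 'M[F]_n) : M \notin unitmx ->
  exists2 v : 'cV_n, v != 0 & M *m v = 0.
Proof.
rewrite -unitmx_tr -row_free_unit -kermx_eq0 => /rowV0Pn[v /sub_kermxP vM v0].
exists v^T; first by rewrite trmx_eq0.
by apply: trmx_inj; rewrite trmx_mul trmxK vM trmx0.
Qed.

Lemma root_char_polyE (F : fieldType) n (A : 'M[F]_n) l :
  root (char_poly A) l = (l%:M - A \notin unitmx).
Proof.
rewrite -eigenvalue_root_char /eigenvalue /eigenspace kermx_eq0 row_free_unit.
by rewrite -opprB -scaleN1r unitmxZ // unitrN1.
Qed.

(** The two real equations say that a + i b is an eigenvector for u + i v. *)
Lemma hurwitz_eigen n (A : 'M[R]_n) u v (a b : 'cV[R]_n) : hurwitz A ->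
  a != 0 \/ b != 0 -> A *m a = u *: a - v *: b -> A *m b = u *: b + v *: a -> u < 0.
Proof.
move=> hA ab Aa Ab; apply: (hA (Complex u v)).
rewrite root_char_polyE; apply/negP => U.
have : (Complex u v)%:M *m cx a b - Cmx A *m cx a b = 0.
  by rewrite mul_scalar_mx cxZ Cmx_cx Aa Ab subrr.
rewrite -mulmxBl => /(congr1 (mulmx (invmx ((Complex u v)%:M - Cmx A)))).
rewrite mulKmx // mulmx0 -cx0 => /cx_inj[a0 b0].
by case: ab; rewrite ?a0 ?b0 eqxx.
Qed.

Lemma hurwitzI n (A : 'M[R]_n) :
  (forall u v (a b : 'cV[R]_n), a != 0 \/ b != 0 ->
     A *m a = u *: a - v *: b -> A *m b = u *: b + v *: a -> u < 0) ->
  hurwitz A.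
Proof.
move=> h [u v]; rewrite root_char_polyE => /nonunit_ker[w].
rewrite [w]cxE; set a := map_mx _ _; set b := map_mx _ _ => w0.
rewrite mulmxBl mul_scalar_mx cxZ Cmx_cx => /eqP; rewrite subr_eq0 => /eqP.
by move=> /cx_inj[Aa Ab]; apply: (h u v a b) => //; exact: cx_eq0.
Qed.

Lemma hurwitz_unit n (A : 'M[R]_n) w : hurwitz A ->
  (Complex 0 w)%:M - Cmx A \in unitmx.
Proof.
move=> hA; apply: contraT; rewrite -root_char_polyE => /hA /=.
by rewrite ltxx.
Qed.

End Complexification.

(** * Lyapunov's theorem *)

Section Lyapunov.
Variable R : realType.

Lemma mxtrace_mul_delta n (A : 'M[R]_n) i j : \tr (A *m delta_mx i j) = A j i.
Proof.
rewrite -(mul_delta_mx (0 : 'I_1)) mulmxA mxtrace_mulC trace_mx11 mulmxA.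
by rewrite -rowE -colE !mxE.
Qed.

(** Free real coefficients reach every symmetric matrix in the form Z + Z^T, so a symmetric unknown
    fits the finite family of [lmi_alternative]. *)
Lemma sum_sym_delta n (z : 'I_n * 'I_n -> R) (Z : 'M[R]_n) :
  Z = \sum_p z p *: delta_mx p.1 p.2 ->
  \sum_p z p *: (delta_mx p.1 p.2 + delta_mx p.2 p.1) = Z + Z^T.
Proof.
move=> ->; rewrite linear_sum -big_split; apply: eq_bigr => p _ /=.
by rewrite scalerDr linearZ /= trmx_delta.
Qed.

Lemma psd_ulsubmx m n (H : 'M[R]_(m + n)) : psd H -> psd (ulsubmx H).
Proof.
move=> [Hs Hp]; split; first by rewrite -[H in RHS]Hs trmx_ulsub.
move=> x; have := Hp (col_mx x 0).
by rewrite -[H]submxK mul_block_col !mulmx0 !addr0 dotv_col dotv0l addr0 submxK.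
Qed.

Lemma psd_drsubmx m n (H : 'M[R]_(m + n)) : psd H -> psd (drsubmx H).
Proof.
move=> [Hs Hp]; split; first by rewrite -[H in RHS]Hs trmx_drsub.
move=> x; have := Hp (col_mx 0 x).
by rewrite -[H]submxK mul_block_col !mulmx0 !add0r dotv_col dotv0l add0r submxK.
Qed.

Lemma psd_tr0 n (H : 'M[R]_n) : psd H -> \tr H = 0 -> H = 0.
Proof.
move=> Hp H0; apply/matrixP => i j; apply/eqP; rewrite mxE -normr_le0 -H0.
exact: psd_entry_bound.
Qed.

(* The row space of [H] is stable under [A^T]; on it the semi-inner product
   defined by [H] is definite and gives the real part of an eigenvalue its sign. *)
Lemma psd_stable_eigen n (A H K : 'M[R]_n) : psd H -> psd K -> H != 0 ->
  A *m H + H *m A^T = K ->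
  exists u v (a b : 'cV[R]_n), [/\ 0 <= u, a != 0 \/ b != 0,
    A *m a = u *: a - v *: b & A *m b = u *: b + v *: a].
Proof.
move=> Hp Kp H0 AH; have [Hs Hq] := Hp.
(* If H x = 0, the form of [K] vanishes at x, hence K x = 0 and H A^T x = 0. Applied to the columns
   of the cokernel of [H], this is the inclusion of row spaces. *)
have stab : (H *m A^T <= H)%MS.
  rewrite submxE; apply/eqP/matrixP => i j.
  set C := cokermx H; have HC : H *m C = 0 by rewrite mulmx_coker.
  pose x := col j C; have Hx : H *m x = 0 by rewrite /x colE mulmxA HC mul0mx.
  have Kx : K *m x = 0.
    apply: psd_ker => //; rewrite -AH mulmxDl -!mulmxA Hx mulmx0 add0r.
    by rewrite dotv_mulmxr Hs Hx dotv0l.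
  move: Kx; rewrite -AH mulmxDl -!mulmxA Hx mulmx0 add0r /x colE !mulmxA -colE.
  by move=> /matrixP/(_ i 0); rewrite [LHS]mxE => ->; rewrite !mxE.
pose B := row_base (Cmx H).
have Bst : (B *m Cmx A^T <= B)%MS.
  rewrite /B (eqmxMr _ (eq_row_base _)) eq_row_base -CmxM.
  by rewrite map_submx.
have [W BW] := submxP Bst.
have [X BX] : exists X, B = X *m Cmx H by apply/submxP; rewrite eq_row_base.
have r0 : (0 < \rank (Cmx H))%N by rewrite mxrank_map lt0n mxrank_eq0.
have [l /eigenvalueP[w wW w0]] := eigenvalue_closed W r0.
pose y := (w *m X)^T.
have yH : Cmx H *m y = (w *m B)^T.
  by rewrite BX mulmxA [RHS]trmx_mul -CmxT Hs.
have wB0 : w *m B != 0 by rewrite mulmx_free_eq0 // row_base_free.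
have eig : Cmx A *m (Cmx H *m y) = l *: (Cmx H *m y).
  rewrite yH -[Cmx A]trmxK -trmx_mul -mulmxA -CmxT BW mulmxA wW.
  by rewrite -scalemxAl linearZ.
have {}wB0 : Cmx H *m y != 0 by rewrite yH trmx_eq0.
move: eig wB0; rewrite [y]cxE; set c := map_mx _ _; set d := map_mx _ _.
case: l wW => u v wW; rewrite !Cmx_cx cxZ => /cx_inj[Ac Ad] /cx_eq0 cd.
exists u, v, (H *m c), (H *m d); split => //.
have qA z : dotv z (A *m (H *m z)) *+ 2 = dotv z (K *m z).
  rewrite -AH mulmxDl dotvDr -!mulmxA mulr2n; congr (_ + _).
  by rewrite [RHS]dotv_mulmxr Hs [RHS]dotv_mulmxr trmxK dotvC.
have q0 : 0 < dotv c (H *m c) + dotv d (H *m d).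
  rewrite lt0r addr_ge0 // andbT; apply/negP;
    rewrite paddr_eq0 // => /andP[/eqP c0 /eqP d0].
  by case: cd; rewrite psd_ker ?eqxx.
have : 0 <= dotv c (K *m c) + dotv d (K *m d) by rewrite addr_ge0 //; exact: (proj2 Kp).
(* At the vector c + i d the form of [K] is 2 u times the form of [H]: the terms in v cancel by
   symmetry. *)
rewrite -!qA Ac Ad !dotvE.
have -> : dotv d (H *m c) = dotv c (H *m d) by rewrite dotv_mulmxr Hs dotvC.
have -> : forall p q r, (u * p - v * q) *+ 2 + (u * r + v * q) *+ 2 =
  (u * 2) * (p + r) by move=> *; ring.
by rewrite pmulr_lge0 // pmulr_lge0.
Qed.

(** Both inequalities are stacked into one block diagonal LMI. A dual certificate would have
    diagonal blocks with A H1 + H1 A^T = 2 H2, and [psd_stable_eigen] would then give an eigenvalue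
    with nonnegative real part. *)
Lemma lyapunov_exists n (A : 'M[R]_n) : hurwitz A ->
  exists Y : 'M[R]_n, [/\ Y^T = Y, posdef Y & posdef (- (Y *m A))].
Proof.
move=> hA; pose S (p : 'I_n * 'I_n) : 'M[R]_n := delta_mx p.1 p.2 + delta_mx p.2 p.1.
have [[z]|[H [Hp H0 HM _]]] := lmi_alternative
  (fun p => block_mx (- (S p *m A)) 0 0 (S p)) (0 : 'M[R]_(n + n)).
  pose Z := \sum_p z p *: delta_mx p.1 p.2; pose Y := Z + Z^T.
  have -> : \sum_p z p *: block_mx (- (S p *m A)) 0 0 (S p) + 0 =
            block_mx (- (Y *m A)) 0 0 Y.
    rewrite addr0 /Y -(sum_sym_delta (z := z)) // mulmx_suml -sumrN.
    apply: (big_ind3 (fun M A B => M = block_mx A 0 0 B)).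
    - by rewrite block_mx0.
    - by move=> _ ? ? _ ? ? -> ->; rewrite add_block_mx !addr0.
    - by move=> p _; rewrite scale_block_mx !scaler0 -scalemxAl scalerN.
  move=> h; exists Y; split; first by rewrite linearD /= trmxK addrC.
  - move=> x x0; have := h (col_mx 0 x); rewrite mul_block_col !mulmx0 !mul0mx !add0r.
    by rewrite dotv_col dotv0l add0r; apply; rewrite col_mx_eq0 negb_and x0 orbT.
  - move=> x x0; have := h (col_mx x 0); rewrite mul_block_col !mulmx0 !mul0mx !addr0.
    by rewrite dotv_col dotv0l addr0; apply; rewrite col_mx_eq0 negb_and x0.
exfalso; pose H1 := ulsubmx H; pose H2 := drsubmx H.
have H1p : psd H1 by exact: psd_ulsubmx.
have H2p : psd H2 by exact: psd_drsubmx.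
have E : A *m H1 + H1 *m A^T = 2 *: H2.
  apply/matrixP => i j; have := HM (i, j).
  rewrite -[H]submxK mulmx_block !mulmx0 !addr0 !add0r mxtrace_block -/H1 -/H2.
  rewrite mulmxN raddfN /= mulmxA mxtrace_mulC mulmxA !mulmxDr !raddfD /=.
  rewrite !mxtrace_mul_delta.
  have -> : H1 *m A^T = (A *m H1)^T by rewrite trmx_mul (proj1 H1p).
  have -> : H2 j i = H2 i j by rewrite -[H2 in LHS](proj1 H2p) mxE.
  by rewrite !mxE; lra.
have K2 : psd (2 *: H2).
  split; first by rewrite linearZ /= (proj1 H2p).
  by move=> x; rewrite -scalemxAl dotvZr mulr_ge0 //; exact: (proj2 H2p).
have H10 : H1 != 0.
  apply/negP => /eqP H10; move/negP: H0; apply; apply/eqP.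
  apply: psd_tr0 => //; rewrite -[H]submxK mxtrace_block -/H1 -/H2 H10.
  move: E; rewrite H10 mulmx0 mul0mx addr0 => /esym/eqP.
  by rewrite scaler_eq0 pnatr_eq0 /= => /eqP ->; rewrite !mxtrace0 addr0.
have [u [v [a [b [u0 ab Aa Ab]]]]] := psd_stable_eigen H1p K2 H10 E.
by have := hurwitz_eigen hA ab Aa Ab; rewrite ltNge u0.
Qed.

(* If [m <= 0] is the minimum of [x^T X x / x^T Y x], then [X - m Y] is psd and
   singular at the minimiser, which contradicts the two Lyapunov inequalities. *)
Lemma lyapunov_pos n (A X : 'M[R]_n) : hurwitz A -> X^T = X ->
  posdef (- (X *m A)) -> posdef X.
Proof.
move=> /lyapunov_exists[Y [Ys Yp YA]] Xs XA x x0; rewrite ltNge; apply/negP => Xx.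
have [d d0 dY] := posdef_gap Yp.
have quad_cont (M : 'M[R]_n) : continuous (fun x : 'cV[R]_n => dotv x (M *m x)).
  apply: continuous_dotv; first exact: entry_cont_id.
  by apply: entry_contM; [exact: entry_cont_cst|exact: entry_cont_id].
pose S := [set y : 'cV[R]_n | dotv y (Y *m y) = 1].
have Sscale y : y != 0 -> exists2 w, S w & exists2 k, k != 0 & y = k *: w.
  move=> y0; have q0 := Yp y y0.
  have s0 : Num.sqrt (dotv y (Y *m y)) != 0 by rewrite gt_eqF // sqrtr_gt0.
  exists ((Num.sqrt (dotv y (Y *m y)))^-1 *: y); last first.
    by exists (Num.sqrt (dotv y (Y *m y))) => //; rewrite scalerA divff // scale1r.
  rewrite /S /= -scalemxAr dotvZl dotvZr mulrA -invfM -expr2 sqr_sqrtr ?ltW // mulVf //.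
  by rewrite gt_eqF.
(* On [S] the gap of [Y] gives |y_i|^2 <= 1/d, hence |y_i| <= 1 + 1/d, which avoids a square
   root. *)
have [||||c c1 cm] := @mx_EVT_min R n 1 S (fun x => dotv x (X *m x)) (1 + d^-1).
- by have [w Sw _] := Sscale x x0; exists w.
- apply: (@closed_comp _ _ (fun y : 'cV[R]_n => dotv y (Y *m y)) [set 1]).
    by move=> ? _; exact: quad_cont.
  exact: closed_eq.
- move=> M; rewrite /S /= => M1 i j; rewrite (ord1 j).
  have Mi : M i 0 ^+ 2 <= dotv M M.
    rewrite /dotv (bigD1 i) //= -expr2 lerDl sumr_ge0 // => k _.
    by rewrite -expr2 sqr_ge0.
  have := dY M; rewrite M1 -ler_pdivlMl // mulr1 => /(le_trans Mi).
  have := sqr_ge0 (M i 0 - 1); have := sqr_ge0 (M i 0 + 1).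
  by move: d^-1 => e; rewrite ler_norml !expr2 => *; apply/andP; split; nra.
- exact: quad_cont.
set m := dotv c (X *m c) in cm.
have c0 : c != 0 by apply/eqP => c0; move: c1; rewrite /S /= c0 dotv0l => /esym/eqP;
  rewrite oner_eq0.
have Xm y : m * dotv y (Y *m y) <= dotv y (X *m y).
  have [->|/Sscale[w Sw [k _ ->]]] := eqVneq y 0; first by rewrite !mulmx0 !dotv0r mulr0.
  rewrite -!scalemxAr !dotvE (_ : dotv w (Y *m w) = 1) // mulr1 mulrC !mulrA -!expr2.
  by rewrite ler_wpM2l ?sqr_ge0 //; exact: cm.
have m0 : m <= 0 by rewrite -(pmulr_rle0 _ (Yp x x0)) mulrC; exact: le_trans (Xm x) Xx.
have XmY : psd (X - m *: Y).
  split; first by rewrite linearB linearZ /= Xs Ys.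
  by move=> y; rewrite mulmxBl dotvDr dotvNr -scalemxAl dotvZr subr_ge0.
have XYc : (X - m *: Y) *m c = 0.
  apply: psd_ker => //; rewrite mulmxBl dotvDr dotvNr -scalemxAl dotvZr -/m.
  by rewrite (_ : dotv c (Y *m c) = 1) // mulr1 subrr.
have : dotv c ((X - m *: Y) *m (A *m c)) = 0.
  by rewrite dotv_mulmxr (proj1 XmY) XYc dotv0l.
rewrite mulmxBl -scalemxAl !dotvE => /eqP; move: (XA c c0) (YA c c0).
rewrite !mulNmx !dotvNr !oppr_gt0 -!mulmxA => p0 q0; rewrite subr_eq0 => /eqP E.
by move: p0; rewrite E ltNge mulr_le0 // ltW.
Qed.

End Lyapunov.

(** * The strict bounded real lemma *)

Section SkewFactor.
Local Open Scope sesquilinear_scope.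

Section Closed.
Variable C : numClosedFieldType.

Lemma adjmxM m n p (A : 'M[C]_(m, n)) (B : 'M[C]_(n, p)) :
  (A *m B)^t* = B^t* *m A^t*.
Proof. by rewrite trmx_mul map_mxM. Qed.

Lemma skew_spectral n (W : 'M[C]_n) : W^t* = - W ->
  exists V : 'M[C]_n, exists e : 'rV[C]_n, [/\ V *m V^t* = 1%:M, V^t* *m V = 1%:M,
    W *m V^t* = V^t* *m diag_mx e & forall i, (e 0 i)^* = - e 0 i].
Proof.
move=> Ws; have Wn : W \is normalmx by apply/normalmxP; rewrite Ws mulmxN mulNmx.
have VU := spectral_unitarymx W.
have := orthomx_spectralP Wn; rewrite invmx_unitary //.
set V := spectralmx W in VU *; set e := spectral_diag W => WE.
have VV : V *m V^t* = 1%:M by apply/unitarymxP.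
have VV' : V^t* *m V = 1%:M by exact: mulmx1C.
exists V, e; split => //; first by rewrite [in LHS]WE -!mulmxA VV mulmx1.
have : diag_mx e = V *m W *m V^t* by rewrite [in RHS]WE !mulmxA VV mul1mx -mulmxA VV
  mulmx1.
move=> E i; have Eii := congr1 (fun M : 'M[C]_n => M i i) E.
have := congr1 (fun M : 'M[C]_n => (M^t*) i i) E.
rewrite /= !adjmxM trmxCK Ws mulNmx mulmxN mulmxA -E !mxE eqxx !mulr1n.
by move=> ->.
Qed.

(** In an orthonormal eigenbasis of [H], let S be its square root. As A H is skew-hermitian, so is
    S^-1 A S on the range of S. A unitary V diagonalising it turns the columns of S V^* into modes
    of [A], and the product of this factor with its adjoint is still S^2 = H. *)
Lemma herm_skew_factor n (A H : 'M[C]_n) : H^t* = H ->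
  (forall v : 'rV[C]_n, 0 <= (v *m H *m v^t*) 0 0) ->
  (A *m H)^t* = - (A *m H) ->
  exists G : 'M[C]_n, exists e : 'rV[C]_n, [/\ H = G *m G^t*, A *m G = G *m diag_mx e &
    forall i, (e 0 i)^* = - e 0 i].
Proof.
move=> Hh Hp AH; have Hn : H \is normalmx by apply/normalmxP; rewrite Hh.
have UU := spectral_unitarymx H.
have := orthomx_spectralP Hn; rewrite invmx_unitary //.
set U := spectralmx H in UU *; set d := spectral_diag H => HE.
have UU1 : U *m U^t* = 1%:M by apply/unitarymxP.
have UU2 : U^t* *m U = 1%:M by exact: mulmx1C.
have dE : diag_mx d = U *m H *m U^t*.
  by rewrite [in RHS]HE !mulmxA UU1 mul1mx -mulmxA UU1 mulmx1.
have d0 i : 0 <= d 0 i.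
  have := Hp (row i U); rewrite -row_mul.
  have -> : (row i (U *m H) *m (row i U)^t*) 0 0 = (U *m H *m U^t*) i i.
    by rewrite !mxE; apply: eq_bigr => k _; rewrite !mxE.
  by rewrite -dE !mxE eqxx mulr1n.
pose s i := sqrtC (d 0 i); pose S := diag_mx (\row_i s i).
have s2 i : s i * s i = d 0 i by rewrite -expr2 sqrtCK.
have s0 i : 0 <= s i by rewrite sqrtC_ge0.
have sC i : (s i)^* = s i by apply/CrealP/ger0_real.
have SC : S^t* = S.
  apply/matrixP => i j; rewrite !mxE rmorphMn /= eq_sym sC.
  by case: eqP => [->|]; rewrite ?mulr0n.
have SS : S *m S = diag_mx d.
  apply/matrixP => i j; rewrite mul_diag_mx !mxE; case: eqP => [->|];
    last by rewrite mulr0.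
  by rewrite !mulr1n s2.
have [At AtE] : exists At, At = U *m A *m U^t* by exists (U *m A *m U^t*).
have Ad : At *m diag_mx d = U *m (A *m H) *m U^t*.
  by rewrite dE AtE !mulmxA -[_ *m U^t* *m U]mulmxA UU2 mulmx1 -!mulmxA.
have Askew i j : At i j * d 0 j = - ((At j i)^* * d 0 i).
  have E : (At *m diag_mx d)^t* = - (At *m diag_mx d).
    by rewrite Ad adjmxM (adjmxM U) AH trmxCK mulNmx mulmxN mulmxA.
  have := congr1 (fun M : 'M[C]_n => M i j) E.
  rewrite /= mul_mx_diag !mxE rmorphM /=.
  have -> : (d 0 i)^* = d 0 i by apply/CrealP/ger0_real.
  by move=> ->; rewrite opprK.
(* [W] is [S^-1 At S], with the kernel of [S] cut out. *)
pose W := \matrix_(i, j) (if (d 0 i != 0) && (d 0 j != 0) then At i j * s j / s i else 0).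
have s_eq0 i : (s i == 0) = (d 0 i == 0) by rewrite sqrtC_eq0.
(* The truncation in [W] loses nothing: where d_i = 0 and d_j is nonzero, skewness of A H forces the
   entry of [At] to vanish. *)
have AS : At *m S = S *m W.
  apply/matrixP => i j; rewrite mul_mx_diag mul_diag_mx !mxE.
  have [di|di] := eqVneq (d 0 i) 0; have [dj|dj] := eqVneq (d 0 j) 0 => /=.
  - by have /eqP -> : s j == 0; rewrite ?s_eq0 ?dj // !mulr0.
  - suff -> : At i j = 0 by rewrite mul0r mulr0.
    by apply/eqP; rewrite -(mulIr_eq0 _ (mulIf dj)) Askew di mulr0 oppr0.
  - by have /eqP -> : s j == 0; rewrite ?s_eq0 ?dj // !mulr0.
  - by rewrite [RHS]mulrC divfK // s_eq0.
have Wskew : W^t* = - W.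
  apply/matrixP => i j; rewrite !mxE andbC; case: ifP => [/andP[di dj]|_]; last first.
    by rewrite rmorph0 oppr0.
  have := Askew i j; rewrite -!s2 !rmorphM fmorphV /= !sC.
  have si : s i != 0 by rewrite s_eq0.
  have sj : s j != 0 by rewrite s_eq0.
  move: ((At j i)^* ) (At i j) => x y /(canRL (mulfK (mulf_neq0 sj sj))) ->.
  by field; rewrite si sj.
have [V [e [VV1 VV2 WV eS]]] := skew_spectral Wskew.
exists (U^t* *m S *m V^t*), e; split => //.
- rewrite !adjmxM !trmxCK SC !mulmxA -[_ *m V^t* *m V]mulmxA VV2 mulmx1.
  by rewrite -[_ *m S *m S]mulmxA SS -HE.
- rewrite !mulmxA -[_ *m V^t* *m diag_mx e]mulmxA -WV.
  rewrite -[RHS]mulmxA [S *m (W *m _)]mulmxA -AS.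
  by rewrite AtE !mulmxA UU2 mul1mx.
Qed.

End Closed.
End SkewFactor.

Section RealSkewFactor.
Variable R : realType.

Lemma cx_mulmx m n p (a b : 'M[R]_(m, n)) (c d : 'M[R]_(n, p)) :
  cx a b *m cx c d = cx (a *m c - b *m d) (a *m d + b *m c).
Proof.
apply/matrixP => i j; rewrite !mxE -sumrB -big_split -sum_Complex.
by apply: eq_bigr => k _; rewrite !mxE; apply/eqP; rewrite eq_complex /= !eqxx.
Qed.

Lemma Cmx_is_cx m n (A : 'M[R]_(m, n)) : Cmx A = cx A 0.
Proof. by apply/matrixP => i j; rewrite !mxE. Qed.

Lemma adj_cx m n (a b : 'M[R]_(m, n)) :
  map_mx Num.conj (cx a b)^T = cx a^T (- b^T).
Proof. by apply/matrixP => i j; rewrite !mxE. Qed.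

(** The real form of A g = i om g for the columns g of Gr + i Gi: each column oscillates at a single
    frequency. *)
Lemma psd_skew_factor n (A H : 'M[R]_n) : psd H -> (A *m H)^T = - (A *m H) ->
  exists Gr Gi : 'M[R]_n, exists om : 'I_n -> R,
    H = Gr *m Gr^T + Gi *m Gi^T /\
    forall k, A *m col k Gr = - (om k *: col k Gi) /\
              A *m col k Gi = om k *: col k Gr.
Proof.
move=> [Hs Hp] AH; have [|||G [e [HG AG eS]]] := @herm_skew_factor R[i] n (Cmx A) (Cmx H).
- by rewrite Cmx_is_cx adj_cx Hs trmx0 oppr0.
- move=> v; rewrite [v]cxE; set a := map_mx _ _; set b := map_mx _ _.
  have q (c d : 'rV[R]_n) : (c *m (H *m d^T)) 0 0 = dotv c^T (H *m d^T).
    by rewrite mxE; apply: eq_bigr => k _; rewrite [c^T _ _]mxE.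
  rewrite -mulmxA adj_cx Cmx_cx cx_mulmx [X in 0 <= X]mxE lecE /= !mulmxN.
  rewrite opprK; apply/andP; split; last by rewrite mxE !q addr_ge0.
  have N (M : 'M[R]_1) : (- M) 0 0 = - M 0 0 by rewrite mxE.
  rewrite mxE N !q [X in - X + _]dotv_mulmxr Hs dotvC.
  by rewrite addNr.
- by rewrite -CmxM Cmx_is_cx adj_cx AH raddf0 cxN !oppr0.
move: HG AG; rewrite [G]cxE; set a := map_mx _ _; set b := map_mx _ _.
rewrite adj_cx cx_mulmx Cmx_is_cx => /cx_inj[HG _] AG.
exists a, b, (fun k => complex.Im (e 0 k)).
split; first by rewrite HG mulmxN opprK.
move=> k; have e0 : complex.Re (e 0 k) = 0.
  have := eS k; case: (e 0 k) => x y /eqP; rewrite eq_complex /= => /andP[/eqP + _].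
  by lra.
have De : diag_mx e *m delta_mx k (0 : 'I_1) = e 0 k *: delta_mx k 0.
  apply/matrixP => i j; rewrite mul_diag_mx !mxE.
  by case: (i =P k) => [->|]; rewrite ?mulr0.
have := congr1 (mulmx^~ (delta_mx k (0 : 'I_1))) AG.
rewrite /= -!mulmxA De -scalemxAr.
have -> : delta_mx k 0 = Cmx (delta_mx k 0) :> 'cV[R[i]]_n.
  by apply/matrixP => i j; rewrite !mxE; case: (_ && _).
rewrite (Cmx_is_cx (delta_mx k 0)) cx_mulmx !mulmx0 subr0 add0r Cmx_cx.
move: e0; case: (e 0 k) => x y /= ->; rewrite cxZ => /cx_inj[].
by rewrite !scale0r sub0r add0r -!colE.
Qed.

End RealSkewFactor.

(** * The frequency-domain inequality and its value at infinity *)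

Section FrequencyBound.
Variable R : realType.

(* The bounded real inequality for the storage function [x^T P x], with [A] and [B]
   standing for [P *m A] and [P *m B]. *)
Definition dissipative n nw nz (g : R) (A : 'M[R]_n) (B : 'M[R]_(n, nw))
    (C : 'M[R]_(nz, n)) (D : 'M[R]_(nz, nw)) :=
  forall (x : 'cV[R]_n) (w : 'cV[R]_nw), x != 0 \/ w != 0 ->
    0 < g ^+ 2 * dotv w w - dotv (C *m x + D *m w) (C *m x + D *m w)
        - 2 * dotv x (A *m x + B *m w).

(* [u1 + i u2] is the state response to the input [w1 + i w2] at frequency [om]. *)
Definition freq_bound n nw nz (s : R) (A : 'M[R]_n) (B : 'M[R]_(n, nw))
    (C : 'M[R]_(nz, n)) (D : 'M[R]_(nz, nw)) :=
  forall (om : R) (u1 u2 : 'cV[R]_n) (w1 w2 : 'cV[R]_nw),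
    A *m u1 + B *m w1 = - (om *: u2) -> A *m u2 + B *m w2 = om *: u1 ->
    dotv (C *m u1 + D *m w1) (C *m u1 + D *m w1)
    + dotv (C *m u2 + D *m w2) (C *m u2 + D *m w2)
    <= s ^+ 2 * (dotv w1 w1 + dotv w2 w2).

Lemma hurwitz_resolvent n (A : 'M[R]_n) om (b1 b2 : 'cV[R]_n) : hurwitz A ->
  exists u1 u2, A *m u1 + b1 = - (om *: u2) /\ A *m u2 + b2 = om *: u1.
Proof.
move=> /(hurwitz_unit om) U.
have := mulKVmx U (cx b1 b2); set v := invmx _ *m _.
rewrite [v]cxE; set u1 := map_mx _ _; set u2 := map_mx _ _.
rewrite mulmxBl mul_scalar_mx cxZ Cmx_cx cxN cxD => /cx_inj[E1 E2].
exists u1, u2; rewrite -E1 -E2; split.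
  by rewrite scale0r sub0r addrCA subrr addr0.
by rewrite scale0r add0r addrCA subrr addr0.
Qed.

Lemma dotvD_le n (x y : 'cV[R]_n) : dotv (x + y) (x + y) <= 2 * dotv x x + 2 * dotv y y.
Proof.
have := dotv_ge0 (x - y); rewrite !dotvE (dotvC y x).
by move: (dotv x x) (dotv x y) (dotv y y) => *; lra.
Qed.

(* The feedthrough [D] is the value of the transfer function at infinity: let [om]
   tend to infinity. *)
Lemma freq_bound_feedthrough n nw nz (s g : R) (A : 'M[R]_n) (B : 'M[R]_(n, nw))
    (C : 'M[R]_(nz, n)) (D : 'M[R]_(nz, nw)) : hurwitz A -> 0 <= s < g ->
  freq_bound s A B C D ->
  forall w, w != 0 -> dotv (D *m w) (D *m w) < g ^+ 2 * dotv w w.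
Proof.
move=> hA /andP[s0 sg] fb w w0; have q0 := dotv_gt0 w0.
have [a a0 aP] := dotv_mulmx_bound A; have [c c0 cP] := dotv_mulmx_bound C.
(* The gap g^2 - s^2 = 2 h is shared out: [eta] costs at most h q in Young's inequality, [U0] limits
   the term in C u1 to h q / 2, and [om] is large enough to force |u1|^2 + |u2|^2 <= U0. *)
set q := dotv w w in q0 *; pose h := (g ^+ 2 - s ^+ 2) / 2.
have h0 : 0 < h by rewrite divr_gt0 // subr_gt0 ltrXn2r // nnegrE ltW // (le_lt_trans s0).
pose eta := h / (s ^+ 2 + 1).
have eta0 : 0 < eta by rewrite divr_gt0 // ltr_wpDl // sqr_ge0.
pose b := dotv (B *m w) (B *m w); have b0 : 0 <= b by exact: dotv_ge0.
pose k := (1 + eta^-1) * c.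
have k0 : 0 < k by rewrite mulr_gt0 // ltr_wpDl // invr_gt0.
pose U0 := h * q / (2 * k).
have U00 : 0 < U0 by apply: divr_gt0; apply: mulr_gt0.
pose om := 2 * a + 2 * b / U0 + 1.
have bU : 0 <= 2 * b / U0 by apply: divr_ge0; [exact: mulr_ge0|exact: ltW].
have [u1 [u2 [E1 E2]]] := hurwitz_resolvent om (B *m w) 0 hA.
have := fb om u1 u2 w 0; rewrite mulmx0 => /(_ E1 E2).
rewrite mulmx0 addr0 dotv0r addr0 -/q => hfb.
set U := dotv u1 u1 + dotv u2 u2.
have U1 : om ^+ 2 * U <= 2 * a * U + 2 * b.
  have e1 : om ^+ 2 * dotv u2 u2 = dotv (A *m u1 + B *m w) (A *m u1 + B *m w).
    by rewrite E1 !dotvE; ring.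
  have e2 : om ^+ 2 * dotv u1 u1 = dotv (A *m u2) (A *m u2).
    by rewrite -[A *m u2]addr0 E2 !dotvE; ring.
  rewrite /U mulrDr e1 e2; have := dotvD_le (A *m u1) (B *m w).
  have := aP u1; have := aP u2; have := dotv_ge0 (A *m u2); rewrite -/b; lra.
have UU : U <= U0.
  rewrite leNgt; apply/negP => UU.
  have omom : om <= om ^+ 2 by rewrite expr2 ler_peMl //; rewrite /om; lra.
  have U_0 : 0 < U by exact: lt_trans UU.
  have : om * U <= 2 * a * U + 2 * b by apply: le_trans U1; rewrite ler_wpM2r // ltW.
  have : 2 * b <= 2 * b / U0 * U.
    by rewrite mulrAC ler_pdivlMr // ler_wpM2l ?mulr_ge0 // ltW.
  by rewrite /om; lra.
set y := C *m u1 + D *m w in hfb.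
have -> : D *m w = y - C *m u1 by rewrite /y addrAC subrr add0r.
clearbody y.
(* |y - e|^2 <= (1 + eta) |y|^2 + (1 + 1/eta) |e|^2 *)
have young : dotv (y - C *m u1) (y - C *m u1) <=
    (1 + eta) * dotv y y + (1 + eta^-1) * dotv (C *m u1) (C *m u1).
  have := dotv_ge0 (eta *: y + C *m u1).
  rewrite !dotvE (dotvC (C *m u1) y) => p0.
  have eV : 0 <= eta^-1 by rewrite invr_ge0 ltW.
  have := mulr_ge0 eV p0; rewrite -[in X in _ -> X]subr_ge0 => /le_trans; apply.
  rewrite le_eqVlt; apply/orP; left; apply/eqP.
  by field; rewrite gt_eqF.
apply: le_lt_trans young _.
have y2 : dotv y y <= s ^+ 2 * q.
  by have := dotv_ge0 (C *m u2); move: hfb; lra.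
have e2 : (1 + eta^-1) * dotv (C *m u1) (C *m u1) <= h * q / 2.
  have -> : h * q / 2 = k * U0 by rewrite /U0; field; rewrite gt_eqF.
  rewrite /k -mulrA ler_wpM2l //; first by rewrite addr_ge0 // invr_ge0 ltW.
  apply: le_trans (cP u1) _; rewrite ler_wpM2l ?(ltW c0) //.
  by apply: le_trans UU; rewrite lerDl dotv_ge0.
have e1 : (1 + eta) * dotv y y <= s ^+ 2 * q + h * q.
  have -> : h = eta * (s ^+ 2 + 1) by rewrite /eta divfK // gt_eqF // ltr_wpDl // sqr_ge0.
  apply: (@le_trans _ _ ((1 + eta) * (s ^+ 2 * q))).
    by rewrite ler_wpM2l // addr_ge0 // ltW.
  have := mulr_gt0 eta0 q0; lra.
have -> : g ^+ 2 = s ^+ 2 + 2 * h by rewrite /h; field.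
have := mulr_gt0 h0 q0; lra.
Qed.

Lemma mxtrace_factor n k (G : 'M[R]_(n, k)) (N : 'M[R]_n) :
  \tr (G *m G^T *m N) = \sum_j dotv (col j G) (N *m col j G).
Proof.
rewrite -mulmxA mxtrace_mulC -mulmxA; apply: eq_bigr => j _.
rewrite mxE; apply: eq_bigr => i _; rewrite [G^T j i]mxE [col j G i 0]mxE.
by congr (_ * _); rewrite colE mulmxA -colE [RHS]mxE.
Qed.

Lemma mxtrace_factor_eq0 n k (N : 'M[R]_n) (Gr Gi : 'M[R]_(n, k)) :
  (forall j, 0 < dotv (col j Gr) (N *m col j Gr) + dotv (col j Gi) (N *m col j Gi) \/
     (col j Gr = 0 /\ col j Gi = 0)) ->
  \tr ((Gr *m Gr^T + Gi *m Gi^T) *m N) <= 0 -> Gr *m Gr^T + Gi *m Gi^T = 0.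
Proof.
move=> h; rewrite mulmxDl mxtraceD !mxtrace_factor -big_split /= => le0.
have z j : col j Gr = 0 /\ col j Gi = 0.
  case: (h j) => // pj; exfalso; move: le0; rewrite leNgt => /negP; apply.
  rewrite (bigD1 j) //= ltr_wpDr // sumr_ge0 // => i _.
  by case: (h i) => [/ltW//|[-> ->]]; rewrite mulmx0 dotv0r addr0.
have -> : Gr = 0 by apply/matrixP => i j; have /colP/(_ i) := (z j).1; rewrite !mxE.
have -> : Gi = 0 by apply/matrixP => i j; have /colP/(_ i) := (z j).2; rewrite !mxE.
by rewrite !mul0mx addr0.
Qed.

End FrequencyBound.

(** * From the frequency bound to a storage function *)

Section KalmanYakubovichPopov.
Variable R : realType.

(** H11 may be singular, so a factor M with H21 = M H11 replaces H21 H11^-1; it exists because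
    positivity forces the kernel of H11 into that of H21. The test vectors (- M^T y, y) isolate the
    Schur complement. *)
Lemma psd_block_schur m n (H : 'M[R]_(m + n)) : psd H ->
  exists M : 'M[R]_(n, m), let R2 := drsubmx H - M *m ursubmx H in
    psd R2 /\
    H = col_mx 1%:M M *m ulsubmx H *m (col_mx 1%:M M)^T
        + col_mx 0 1%:M *m R2 *m (col_mx 0 1%:M)^T.
Proof.
move=> Hp; have [Hs Hq] := Hp; set H11 := ulsubmx H; set H12 := ursubmx H.
set H21 := dlsubmx H; set H22 := drsubmx H.
have HE : H = block_mx H11 H12 H21 H22 by rewrite submxK.
have s11 : H11^T = H11 by rewrite trmx_ulsub Hs.
have s22 : H22^T = H22 by rewrite trmx_drsub Hs.
have s12 : H12^T = H21 by rewrite trmx_ursub Hs.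
have /submxP[M ME] : (H21 <= H11)%MS.
  rewrite submxE; apply/eqP/matrixP => i j.
  set C := cokermx H11; have HC : H11 *m C = 0 by rewrite mulmx_coker.
  have Hx : H11 *m col j C = 0 by rewrite colE mulmxA HC mul0mx.
  have : H *m col_mx (col j C) 0 = 0.
    apply: psd_ker => //; rewrite HE mul_block_col !mulmx0 !addr0 Hx.
    by rewrite dotv_col dotv0r dotv0l addr0.
  rewrite HE mul_block_col !mulmx0 !addr0 Hx -col_mx0 => /eq_col_mx[_].
  by rewrite colE mulmxA -colE => /matrixP/(_ i 0); rewrite [LHS]mxE => ->; rewrite !mxE.
have ME' : H12 = H11 *m M^T by rewrite -[H12]trmxK s12 ME trmx_mul s11.
have MH : M *m H12 = H21 *m M^T by rewrite ME' mulmxA -ME.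
exists M; split; last first.
  rewrite !tr_col_mx !trmx1 trmx0 -/H11 (mul_col_mx _ _ H11) (mul_col_mx _ _ (_ - _)).
  rewrite !mul1mx !mul0mx !mul_col_row !mulmx1 !mulmx0 add_block_mx !addr0.
  by rewrite -/H12 -/H22 MH -ME -ME' addrC subrK.
split; first by rewrite linearB /= s22 ME' !trmx_mul trmxK s11 mulmxA.
move=> y; have := Hq (col_mx (- (M^T *m y)) y).
rewrite HE mul_block_col !mulmxN mulmxA -ME' addNr dotv_col dotv0r add0r.
by rewrite mulmxBl MH -mulmxA addrC.
Qed.

(** Deliberately not symmetric: only the quadratic form matters, so the whole term in [B] sits in
    the upper right block and [A] needs no symmetrisation. *)
Definition dissmx n nw nz (g : R) (A : 'M[R]_n) (B : 'M[R]_(n, nw))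
    (C : 'M[R]_(nz, n)) (D : 'M[R]_(nz, nw)) : 'M[R]_(n + nw) :=
  block_mx (- (C^T *m C) - 2 *: A) (- (C^T *m D) - 2 *: B)
    (- (D^T *m C)) (g ^+ 2 *: 1%:M - D^T *m D).

Lemma dissmxE n nw nz (g : R) (A : 'M[R]_n) (B : 'M[R]_(n, nw))
    (C : 'M[R]_(nz, n)) (D : 'M[R]_(nz, nw)) x w :
  dotv (col_mx x w) (dissmx g A B C D *m col_mx x w) =
  g ^+ 2 * dotv w w - dotv (C *m x + D *m w) (C *m x + D *m w)
    - 2 * dotv x (A *m x + B *m w).
Proof.
rewrite mul_block_col dotv_col !mulNmx !mulmxBl !mulNmx -!scalemxAl mul1mx -!mulmxA.
rewrite !dotvE (dotv_mulmxr C^T x) (dotv_mulmxr C^T x) !(dotv_mulmxr D^T w) !trmxK.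
rewrite (dotvC (D *m w) (C *m x)).
by ring.
Qed.

Lemma dissipativeP n nw nz (g : R) (A : 'M[R]_n) (B : 'M[R]_(n, nw))
    (C : 'M[R]_(nz, n)) (D : 'M[R]_(nz, nw)) :
  dissipative g A B C D <-> posdef (dissmx g A B C D).
Proof.
split=> [h x|h x w xw].
  rewrite -[x]vsubmxK dissmxE col_mx_eq0 negb_and => /orP; exact: h.
by rewrite -dissmxE; apply: h; rewrite col_mx_eq0 negb_and; apply/orP.
Qed.

(* In the second alternative write H11 for the upper left block of [H] and
   H21 = M H11.  Then (A + B M) H11 is skew, so the columns of the factors of H11
   are responses of the system at finite frequencies; the Schur complement [R2]
   carries the frequency infinity. *)
Lemma kyp n nw nz (s g : R) (A : 'M[R]_n) (B : 'M[R]_(n, nw))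
    (C : 'M[R]_(nz, n)) (D : 'M[R]_(nz, nw)) : hurwitz A -> 0 <= s < g ->
  freq_bound s A B C D ->
  exists P : 'M[R]_n, [/\ P^T = P, posdef P & dissipative g (P *m A) (P *m B) C D].
Proof.
move=> hA sg fb; have Dfb := freq_bound_feedthrough hA sg fb.
have sg2 : s ^+ 2 < g ^+ 2.
  by case/andP: sg => s0 sg; rewrite ltrXn2r // nnegrE ltW // (le_lt_trans s0).
pose S (p : 'I_n * 'I_n) : 'M[R]_n := delta_mx p.1 p.2 + delta_mx p.2 p.1.
pose N := dissmx g 0 0 C D.
have NE x w : dotv (col_mx x w) (N *m col_mx x w) =
    g ^+ 2 * dotv w w - dotv (C *m x + D *m w) (C *m x + D *m w).
  by rewrite dissmxE !mul0mx addr0 dotv0r mulr0 subr0.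
have [[z h]|[H [Hp H0 HM HN]]] := lmi_alternative
  (fun p => block_mx (- (S p *m A)) (- (S p *m B)) 0 0 : 'M[R]_(n + nw)) N.
  pose Z := \sum_p z p *: delta_mx p.1 p.2; pose Y := Z + Z^T.
  have YE : \sum_p z p *: (block_mx (- (S p *m A)) (- (S p *m B)) 0 0 : 'M[R]_(n + nw)) =
            block_mx (- (Y *m A)) (- (Y *m B)) 0 0.
    rewrite /Y -(sum_sym_delta (z := z)) // !mulmx_suml -!sumrN.
    apply: (big_ind3 (fun M A B => M = block_mx A B 0 0)).
    - by rewrite block_mx0.
    - by move=> _ ? ? _ ? ? -> ->; rewrite add_block_mx !addr0.
    - by move=> p _; rewrite scale_block_mx !scaler0 -!scalemxAl !scalerN.
  have diss : dissipative g (2^-1 *: Y *m A) (2^-1 *: Y *m B) C D.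
    move=> x w xw; have := h (col_mx x w).
    rewrite col_mx_eq0 negb_and (introT orP xw) => /(_ isT).
    rewrite mulmxDl dotvDr NE YE mul_block_col !mul0mx !addr0 dotv_col dotv0r addr0.
    rewrite !mulNmx -!scalemxAl -scalerDr !dotvE.
    by rewrite mulrA divff // mul1r; lra.
  exists (2^-1 *: Y); have Ys : Y^T = Y by rewrite linearD /= trmxK addrC.
  have Ps : (2^-1 *: Y)^T = 2^-1 *: Y by rewrite linearZ /= Ys.
  (* The LMI does not impose positivity of the storage matrix: at w = 0 it gives a Lyapunov
     inequality, and stability of [A] does the rest. *)
  split => //; apply: (lyapunov_pos hA) => // x x0.
  have := diss x 0 (or_introl x0); rewrite !mulmx0 !addr0 dotv0r mulr0 sub0r.
  have := dotv_ge0 (C *m x); rewrite mulNmx dotvNr; lra.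
exfalso; have [M [Rp HE]] := psd_block_schur Hp.
set R2 := drsubmx H - _ in Rp HE; set H11 := ulsubmx H in HE.
have H11p : psd H11 by exact: psd_ulsubmx.
have H21E : dlsubmx H = M *m H11.
  rewrite [in LHS]HE !tr_col_mx !trmx1 trmx0 (mul_col_mx _ _ H11) (mul_col_mx _ _ R2).
  by rewrite !mul1mx !mul0mx !mul_col_row !mulmx1 !mulmx0 add_block_mx block_mxKdl addr0.
have skew : ((A + B *m M) *m H11)^T = - ((A + B *m M) *m H11).
  apply/matrixP => i j; have := HM (j, i).
  rewrite -[H]submxK mulmx_block !mulmx0 !addr0 mxtrace_block -/H11 H21E.
  rewrite !mulmxN !raddfN /= !mulmxA mxtrace_mulC mulmxA [X in _ + - X](mxtrace_mulC _ B).
  rewrite !mulmxA !mulmxDr !raddfD /= !mxtrace_mul_delta.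
  rewrite mulmxDl !mxE => e; apply/eqP; rewrite -addr_eq0; apply/eqP; move: e; lra.
have [Gr [Gi [om [GE GA]]]] := psd_skew_factor H11p skew.
(* With A = 0 the skewness condition is trivial, and only the factorisation of [R2] is kept. *)
have [|Rr [Ri [_ [RE _]]]] := psd_skew_factor (A := 0) Rp.
  by rewrite mul0mx trmx0 oppr0.
pose E1 : 'M[R]_(n + nw, n) := col_mx 1%:M M.
pose E2 : 'M[R]_(n + nw, nw) := col_mx 0 1%:M.
pose Tr := row_mx (E1 *m Gr) (E2 *m Rr); pose Ti := row_mx (E1 *m Gi) (E2 *m Ri).
have HT : H = Tr *m Tr^T + Ti *m Ti^T.
  rewrite /Tr /Ti !tr_row_mx !mul_row_col !trmx_mul -/E1 -/E2 in HE *.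
  rewrite [LHS]HE GE RE !mulmxDr !mulmxDl !mulmxA -!addrA; congr (_ + _).
  by rewrite addrCA.
have C1 j (G : 'M[R]_n) : col j (E1 *m G) = col_mx (col j G) (M *m col j G).
  by rewrite colE -mulmxA -colE mul_col_mx mul1mx.
have C2 j (G : 'M[R]_nw) : col j (E2 *m G) = col_mx 0 (col j G).
  by rewrite colE -mulmxA -colE mul_col_mx mul0mx mul1mx.
move/negP: H0; apply; apply/eqP; rewrite HT; apply: (mxtrace_factor_eq0 (N := N));
  last by rewrite -HT.
move=> j; case: (splitP j) => k jk.
  have -> : j = lshift nw k by exact: val_inj.
  rewrite !colKl !C1 !NE; have [Ar Ai] := GA k.
  set gr := col k Gr in Ar *; set gi := col k Gi in Ai *.
  have fr : A *m gr + B *m (M *m gr) = - (om k *: gi) by rewrite -Ar mulmxDl mulmxA.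
  have fi : A *m gi + B *m (M *m gi) = om k *: gr by rewrite -Ai mulmxDl mulmxA.
  have fbk := fb _ _ _ _ _ fr fi.
  (* If the input M g vanishes, the state g is an eigenvector of [A] on the imaginary axis unless it
     is zero; stability leaves only zero. *)
  have [W0|W0] := eqVneq (dotv (M *m gr) (M *m gr) + dotv (M *m gi) (M *m gi)) 0.
    right; move/eqP: W0; rewrite paddr_eq0 ?dotv_ge0 // =>
      /andP[/eqP/dotv_eq0 r0 /eqP/dotv_eq0 i0].
    have [gr0 gi0] : gr = 0 /\ gi = 0.
      apply: contrapT => gn; have nz' : gr != 0 \/ gi != 0.
        have [gr0|] := eqVneq gr 0; last by left.
        by right; apply/eqP => gi0; apply: gn.
      have := hurwitz_eigen (u := 0) (v := om k) hA nz'.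
      rewrite !scale0r sub0r add0r ltxx -fr -fi r0 i0 !mulmx0 !addr0.
      by move=> /(_ erefl erefl).
    by rewrite gr0 gi0 mulmx0 col_mx0.
  left; have {}W0 : 0 < dotv (M *m gr) (M *m gr) + dotv (M *m gi) (M *m gi).
    by rewrite lt0r W0 addr_ge0 // dotv_ge0.
  have : 0 < (g ^+ 2 - s ^+ 2) * (dotv (M *m gr) (M *m gr) + dotv (M *m gi) (M *m gi)).
    by rewrite mulr_gt0 // subr_gt0.
  by move: fbk; lra.
have -> : j = rshift n k by exact: val_inj.
rewrite !colKr !C2 !NE !mulmx0 !add0r.
have dD w : w != 0 -> 0 < g ^+ 2 * dotv w w - dotv (D *m w) (D *m w).
  by move=> w0; rewrite subr_gt0; exact: Dfb.
have dD0 w : 0 <= g ^+ 2 * dotv w w - dotv (D *m w) (D *m w).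
  by have [->|/dD/ltW//] := eqVneq w 0; rewrite mulmx0 !dotv0r mulr0 subrr.
have [r0|r0] := eqVneq (col k Rr) 0; last by left; rewrite ltr_pwDl ?dD.
have [i0|i0] := eqVneq (col k Ri) 0; last by left; rewrite ltr_wpDl ?dD.
by right; rewrite r0 i0 col_mx0.
Qed.

End KalmanYakubovichPopov.

(** * The bounded real lemma for the H-infinity norm *)

Section BoundedReal.
Variable R : realType.

Lemma sigma_max_bound p q (M : 'M[R[i]]_(p, q)) s (a b : 'cV[R]_q) (c d : 'cV[R]_p) :
  0 <= s -> sigma_max M <= s -> M *m cx a b = cx c d ->
  dotv c c + dotv d d <= s ^+ 2 * (dotv a a + dotv b b).
Proof.
move=> s0 Ms Mab; set nab := _ + dotv b b.
have [nab0|nab0] := eqVneq nab 0.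
  move/eqP: (nab0); rewrite paddr_eq0 ?dotv_ge0 // =>
    /andP[/eqP/dotv_eq0 a0 /eqP/dotv_eq0 b0].
  move: Mab; rewrite a0 b0 cx0 mulmx0 -cx0 => /cx_inj[<- <-].
  by rewrite dotv0r addr0 nab0 mulr0.
have {}nab0 : 0 < nab by rewrite lt0r nab0 addr_ge0 // dotv_ge0.
pose k := Num.sqrt nab; have k0 : 0 < k by rewrite sqrtr_gt0.
have kk : k ^+ 2 = nab by rewrite sqr_sqrtr // ltW.
set X := [set x | exists v : 'cV[R[i]]_q, cvnorm v = 1 /\ x = cvnorm (M *m v)].
(* Needed because [sup] of an unbounded set is a default value, which would bound nothing. *)
have Xb : has_ubound X.
  pose M1 := map_mx (@complex.Re R) M; pose M2 := map_mx (@complex.Im R) M.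
  have [c1 c10 c1P] := dotv_mulmx_bound M1; have [c2 c20 c2P] := dotv_mulmx_bound M2.
  exists (Num.sqrt (2 * c1 + 2 * c2)) => _ [v [v1 ->]].
  move: v1; rewrite [v]cxE [M]cxE -/M1 -/M2; set x := map_mx _ _; set y := map_mx _ _.
  rewrite cx_mulmx !cvnorm_cx => v1; rewrite ler_wsqrtr //.
  have {}v1 : dotv x x + dotv y y = 1.
    by rewrite -[LHS]sqr_sqrtr ?v1 ?expr1n // addr_ge0 // dotv_ge0.
  have := dotvD_le (M1 *m x) (- (M2 *m y)); have := dotvD_le (M1 *m y) (M2 *m x).
  have := c1P x; have := c1P y; have := c2P x; have := c2P y.
  rewrite !(dotvNl, dotvNr) opprK.
  have -> : 2 * c1 + 2 * c2 =
    (2 * c1 + 2 * c2) * (dotv x x + dotv y y) by rewrite v1 mulr1.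
  lra.
have : X (cvnorm (M *m cx (k^-1 *: a) (k^-1 *: b))).
  exists (cx (k^-1 *: a) (k^-1 *: b)); split => //.
  rewrite cvnorm_cx !dotvE !mulrA -mulrDr -expr2 exprVn kk mulVf ?sqrtr1 //.
  by rewrite gt_eqF.
move=> /(ub_le_sup Xb) /le_trans/(_ Ms).
have -> : M *m cx (k^-1 *: a) (k^-1 *: b) = cx (k^-1 *: c) (k^-1 *: d).
  have E m (x y : 'cV[R]_m) : cx (k^-1 *: x) (k^-1 *: y) = Complex k^-1 0 *: cx x y.
    by rewrite cxZ !scale0r subr0 addr0.
  by rewrite !E -scalemxAr Mab.
rewrite cvnorm_cx => h.
have nn : 0 <= dotv (k^-1 *: c) (k^-1 *: c) + dotv (k^-1 *: d) (k^-1 *: d).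
  by rewrite addr_ge0 // dotv_ge0.
have : Num.sqrt (dotv (k^-1 *: c) (k^-1 *: c) + dotv (k^-1 *: d) (k^-1 *: d)) ^+ 2 <= s
  ^+ 2.
  by rewrite lerXn2r // nnegrE sqrtr_ge0.
rewrite sqr_sqrtr // !dotvE !mulrA -mulrDr -expr2 exprVn kk mulrC.
by rewrite ler_pdivrMr.
Qed.

Variables (n nw nz : nat) (A : 'M[R]_n) (B : 'M[R]_(n, nw))
  (C : 'M[R]_(nz, n)) (D : 'M[R]_(nz, nw)) (g : R).

(** [Tzw] freed from the plant, so that the lemma applies to any quadruple; [hinf_normE] identifies
    the two by conversion. *)
Definition transfer (s : R[i]) : 'M[R[i]]_(nz, nw) :=
  Cmx C *m invmx (s%:M - Cmx A) *m Cmx B + Cmx D.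

Lemma transfer_cx om (u1 u2 : 'cV[R]_n) (w1 w2 : 'cV[R]_nw) : hurwitz A ->
  A *m u1 + B *m w1 = - (om *: u2) -> A *m u2 + B *m w2 = om *: u1 ->
  transfer (Complex 0 om) *m cx w1 w2 = cx (C *m u1 + D *m w1) (C *m u2 + D *m w2).
Proof.
move=> hA E1 E2; have U := hurwitz_unit om hA.
have E : Cmx B *m cx w1 w2 = ((Complex 0 om)%:M - Cmx A) *m cx u1 u2.
  rewrite mulmxBl mul_scalar_mx cxZ !Cmx_cx cxN cxD -E2 !scale0r sub0r -E1 add0r.
  by congr cx; rewrite addrAC subrr add0r.
by rewrite mulmxDl -!mulmxA E mulKmx // !Cmx_cx cxD.
Qed.

Lemma transfer_solve om (w1 w2 : 'cV[R]_nw) : hurwitz A -> exists u1 u2,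
  [/\ A *m u1 + B *m w1 = - (om *: u2), A *m u2 + B *m w2 = om *: u1 &
  transfer (Complex 0 om) *m cx w1 w2 = cx (C *m u1 + D *m w1) (C *m u2 + D *m w2)].
Proof.
move=> hA; have [u1 [u2 [E1 E2]]] := hurwitz_resolvent om (B *m w1) (B *m w2) hA.
by exists u1, u2; split => //; exact: transfer_cx.
Qed.

Definition hinf : \bar R :=
  ereal_sup [set (sigma_max (transfer (Complex 0 w)))%:E | w in [set: R]].

Lemma hinf_freq_bound : hurwitz A -> 0 < g -> (hinf < g%:E)%E ->
  exists2 s, 0 <= s < g & freq_bound s A B C D.
Proof.
move=> hA g0 hg.
have ub w : ((sigma_max (transfer (Complex 0 w)))%:E <= hinf)%E.
  by apply: ereal_sup_ubound; exists w.
have [s sg sP] : exists2 s, 0 <= s < g & forall w, sigma_max (transfer (Complex 0 w))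
  <= s.
  move: hg ub; case: hinf => [r||] //.
    rewrite lte_fin => rg ub; exists (Num.max 0 r) => [|w].
      by rewrite le_max lexx gt_max g0.
    by rewrite le_max; apply/orP; right; rewrite -lee_fin.
  by move=> _ /(_ 0); rewrite leNgt ltNyr.
exists s => // om u1 u2 w1 w2 E1 E2; case/andP: sg => s0 _.
exact: (sigma_max_bound s0 (sP om) (transfer_cx hA E1 E2)).
Qed.

(** Lyapunov's argument on a complex eigenvector: at w = 0 the form of P A is negative, and it
    equals u times the positive form of P, the terms in v cancelling by symmetry. *)
Lemma dissipative_hurwitz (P : 'M[R]_n) : P^T = P -> posdef P ->
  dissipative g (P *m A) (P *m B) C D -> hurwitz A.
Proof.
move=> Ps Pp diss; apply: hurwitzI => u v a b ab Aa Ab.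
have q x : x != 0 -> dotv x (P *m (A *m x)) < 0.
  move=> x0; have := diss x 0 (or_introl x0).
  rewrite !mulmx0 !addr0 dotv0r mulr0 -mulmxA; have := dotv_ge0 (C *m x); lra.
have q' x : dotv x (P *m (A *m x)) <= 0.
  by have [->|/q/ltW//] := eqVneq x 0; rewrite dotv0l.
have p' x : 0 <= dotv x (P *m x).
  by have [->|/Pp/ltW//] := eqVneq x 0; rewrite dotv0l.
have lt0 : dotv a (P *m (A *m a)) + dotv b (P *m (A *m b)) < 0.
  by case: ab => [/q|/q] h; [rewrite ltr_nwDl|rewrite ltr_nwDr].
have gt0 : 0 < dotv a (P *m a) + dotv b (P *m b).
  by case: ab => [/Pp|/Pp] h; [rewrite ltr_pwDl|rewrite ltr_pwDr].
move: lt0; rewrite Aa Ab mulmxBr mulmxDr -!scalemxAr !dotvE.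
have -> : dotv b (P *m a) = dotv a (P *m b) by rewrite dotv_mulmxr Ps dotvC.
set X := (X in X < 0);
  have -> : X = u * (dotv a (P *m a) + dotv b (P *m b)) by rewrite /X; ring.
by rewrite pmulr_llt0.
Qed.

Lemma dissipative_hinf (P : 'M[R]_n) : 0 < g -> P^T = P -> posdef P ->
  dissipative g (P *m A) (P *m B) C D -> (hinf < g%:E)%E.
Proof.
move=> g0 Ps Pp diss; have hA := dissipative_hurwitz Ps Pp diss.
(* A pointwise strict bound would only give a supremum <= g; the gap [d] makes it uniform in
   frequency. *)
have /dissipativeP/posdef_gap[d d0 dP] := diss.
pose s := Num.sqrt (g ^+ 2 - d).
have sg : s < g.
  by rewrite -[ltRHS]gtr0_norm // -sqrtr_sqr ltr_sqrt ?exprn_gt0 // ltrBlDr ltrDl.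
apply: (@le_lt_trans _ _ s%:E); last by rewrite lte_fin.
apply: ub_ereal_sup => _ [om _ <-]; rewrite lee_fin.
rewrite /sigma_max; set X := [set x | _].
(* There are no unit vectors when nw = 0; the empty supremum is 0. *)
have [->|/set0P X0] := eqVneq X set0; first by rewrite sup0 sqrtr_ge0.
apply: ge_sup => // _ [v [+ ->]]; rewrite [v]cxE.
set w1 := map_mx _ _; set w2 := map_mx _ _; rewrite cvnorm_cx => v1.
have {}v1 : dotv w1 w1 + dotv w2 w2 = 1.
  by rewrite -[LHS]sqr_sqrtr ?v1 ?expr1n // addr_ge0 // dotv_ge0.
have [u1 [u2 [E1 E2 ->]]] := transfer_solve om w1 w2 hA.
rewrite cvnorm_cx ler_wsqrtr //.
have := dP (col_mx u1 w1); have := dP (col_mx u2 w2); rewrite !dissmxE !dotv_col.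
rewrite -!mulmxA -!mulmxDr E1 E2 !(mulmxN, dotvNr) -!scalemxAr !dotvZr.
(* Along a sinusoidal response the storage terms cancel by symmetry of [P], leaving only input and
   output energy. *)
have -> : dotv u2 (P *m u1) = dotv u1 (P *m u2) by rewrite dotv_mulmxr Ps dotvC.
have := mulr_ge0 (ltW d0) (dotv_ge0 u1); have := mulr_ge0 (ltW d0) (dotv_ge0 u2).
have -> : dotv w2 w2 = 1 - dotv w1 w1 by rewrite -v1; ring.
lra.
Qed.

Lemma hinf_dissipative : 0 < g -> hurwitz A -> (hinf < g%:E)%E ->
  exists P : 'M[R]_n, [/\ P^T = P, posdef P & dissipative g (P *m A) (P *m B) C D].
Proof.
move=> g0 hA /(hinf_freq_bound hA g0)[s sg fb]; exact: kyp hA sg fb.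
Qed.

End BoundedReal.

(** * The linearising change of variables *)

Section Congruence.
Variable R : realType.

Lemma dissipative_congr n nw nz (g : R) (A : 'M[R]_n) (B : 'M[R]_(n, nw))
    (C : 'M[R]_(nz, n)) (D : 'M[R]_(nz, nw)) (T : 'M[R]_n) : T \in unitmx ->
  dissipative g A B C D ->
  dissipative g (T^T *m A *m T) (T^T *m B) (C *m T) D.
Proof.
move=> Tu h x w xw; rewrite -!mulmxA -mulmxDr dotv_mulmxr trmxK; apply: h.
case: xw => [x0|]; [left|by right].
apply: contra x0 => /eqP Tx; apply/eqP.
by rewrite -(mulKmx Tu x) Tx mulmx0.
Qed.

Lemma posdef_congr n (M T : 'M[R]_n) : T \in unitmx -> posdef M ->
  posdef (T^T *m M *m T).
Proof.
move=> Tu h x x0; rewrite -!mulmxA dotv_mulmxr trmxK; apply: h.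
apply: contra x0 => /eqP Tx; apply/eqP.
by rewrite -(mulKmx Tu x) Tx mulmx0.
Qed.

(** The [size p] distinct points e / (k + 1) cannot all be roots. *)
Lemma exists_nonroot (p : {poly R}) e : p != 0 -> 0 < e ->
  exists2 t, 0 < t <= e & p.[t] != 0.
Proof.
move=> p0 e0; apply: contrapT => h.
pose s := [seq e / k.+1%:R | k <- iota 0 (size p)].
have : (size s < size p)%N.
  apply: max_poly_roots => //.
    apply/allP => _ /mapP[k _ ->]; apply/negP => /negP nr; apply: h.
    exists (e / k.+1%:R) => //; rewrite divr_gt0 ?ltr0n //=.
    by rewrite ler_pdivrMr ?ltr0n // ler_peMr ?(ltW e0) // ler1n.
  rewrite map_inj_uniq ?iota_uniq // => i j /(mulfI (lt0r_neq0 e0)) /invr_inj /eqP.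
  by rewrite eqr_nat eqSS => /eqP.
by rewrite size_map size_iota ltnn.
Qed.

Lemma horner_char_poly n (M : 'M[R]_n) t : (char_poly M).[t] = \det (t%:M - M).
Proof.
rewrite -horner_evalE -det_map_mx; congr (\det _).
by apply/matrixP => i j;
  rewrite !mxE [LHS]horner_evalE hornerD hornerN hornerC hornerMn hornerX.
Qed.

Lemma char_poly_neq0 n (M : 'M[R]_n) : char_poly M != 0.
Proof. by rewrite monic_neq0 // char_poly_monic. Qed.

(** The determinant of M + t is the characteristic polynomial of - M at t. *)
Lemma exists_unit_shift n (M : 'M[R]_n) e : 0 < e ->
  exists2 t, 0 < t <= e & M + t%:M \in unitmx.
Proof.
move=> e0; have [t te] := exists_nonroot (char_poly_neq0 (- M)) e0.
by rewrite horner_char_poly opprK addrC => d0; exists t; rewrite // unitmxE unitfE.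
Qed.

End Congruence.

(** * Passing between controllers and feasible triples *)

Section ChangeOfVariables.
Variables (R : realType) (nx nw nu ny nz : nat) (pl : plant R nx nw nu ny nz).
Local Notation A := (pA pl).
Local Notation B1 := (pB1 pl).
Local Notation B2 := (pB2 pl).
Local Notation C1 := (pC1 pl).
Local Notation D11 := (pD11 pl).
Local Notation D12 := (pD12 pl).
Local Notation C2 := (pC2 pl).
Local Notation D21 := (pD21 pl).
Local Notation ctrl := 'M[R]_(nu + nx, ny + nx).
Implicit Types (X Y U V : 'M[R]_nx) (Z K : ctrl).

(* In the notation of Scherer, Gahinet and Chilali, P = [X U; U^T *] has inverse
   [Y V^T; V *], and [Z] is the matrix [Dhat Chat; Bhat Ahat], affine in the
   controller: Z = lift_l * K * lift_r + lift_shift.  The inequality becomes affine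
   because P * pi_mx = theta and pi_mx^T * P * pi_mx = gram. *)
Definition input_mx : 'M[R]_(nx + nx, nu + nx) := block_mx B2 0 0 1%:M.

Definition lift_l X U : 'M[R]_(nu + nx) := block_mx 1%:M 0 (X *m B2) U.
Definition lift_r Y V : 'M[R]_(ny + nx) := block_mx 1%:M (C2 *m Y) 0 V.
Definition lift_shift X Y : ctrl := block_mx 0 0 0 (X *m A *m Y).

Definition theta X U : 'M[R]_(nx + nx) := block_mx 1%:M X 0 U^T.
Definition pi_mx Y V : 'M[R]_(nx + nx) := block_mx Y 1%:M V 0.
Definition gram X Y : 'M[R]_(nx + nx) := block_mx Y 1%:M 1%:M X.

Definition lmiA X Y Z : 'M[R]_(nx + nx) := block_mx (A *m Y) A 0 (X *m A)
  + input_mx *m Z *m block_mx 0 C2 1%:M 0.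
Definition lmiB X Z : 'M[R]_(nx + nx, nw) :=
  col_mx B1 (X *m B1) + input_mx *m Z *m col_mx D21 0.
Definition lmiC Y Z : 'M[R]_(nz, nx + nx) :=
  row_mx (C1 *m Y) C1 + row_mx D12 0 *m Z *m block_mx 0 C2 1%:M 0.
Definition lmiD Z : 'M[R]_(nz, nw) := D11 + row_mx D12 0 *m Z *m col_mx D21 0.

Definition lmi_feasible (g : R) X Y Z := [/\ X^T = X, Y^T = Y, posdef (gram X Y) &
  dissipative g (lmiA X Y Z) (lmiB X Z) (lmiC Y Z) (lmiD Z)].

Lemma AclE K : Acl pl K = block_mx A 0 0 0 + input_mx *m K *m block_mx C2 0 0 1%:M.
Proof.
rewrite -{2}[K]submxK /input_mx !mulmx_block.
by rewrite !mul0mx !mulmx0 !mul1mx !mulmx1 !addr0 !add0r add_block_mx !add0r.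
Qed.

Lemma BclE K : Bcl pl K = col_mx B1 0 + input_mx *m K *m col_mx D21 0.
Proof.
rewrite -{2}[K]submxK /input_mx mulmx_block mul_block_col.
by rewrite !mul0mx !mulmx0 !mul1mx !addr0 !add0r add_col_mx add0r.
Qed.

Lemma CclE K : Ccl pl K = row_mx C1 0 + row_mx D12 0 *m K *m block_mx C2 0 0 1%:M.
Proof.
rewrite -{2}[K]submxK mul_row_block mul_row_block.
by rewrite !mul0mx !mulmx0 !mulmx1 !addr0 !add0r add_row_mx add0r.
Qed.

Lemma DclE K : Dcl pl K = D11 + row_mx D12 0 *m K *m col_mx D21 0.
Proof.
rewrite -{2}[K]submxK mul_row_block mul_row_col.
by rewrite !mul0mx !mulmx0 !addr0.
Qed.

Section Lift.
Variables (X Y U V : 'M[R]_nx) (K : ctrl).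
Hypothesis Xs : X^T = X.

Let Z := lift_l X U *m K *m lift_r Y V + lift_shift X Y.

(** This and the next three identities push the congruence factors through the fixed matrices around
    [K], where they reappear as [lift_l] and [lift_r]. *)
Lemma theta_input : (theta X U)^T *m input_mx = input_mx *m lift_l X U.
Proof.
rewrite /theta tr_block_mx !mulmx_block trmx1 trmx0 trmxK Xs.
by rewrite !mul0mx !mulmx0 !mul1mx !mulmx1 !addr0 !add0r.
Qed.

Lemma output_pi : block_mx C2 0 0 1%:M *m pi_mx Y V =
  lift_r Y V *m block_mx 0 C2 1%:M 0.
Proof.
rewrite !mulmx_block.
by rewrite !mul0mx !mulmx0 !mul1mx !mulmx1 !addr0 !add0r.
Qed.

Lemma row_lift_l : row_mx D12 0 *m lift_l X U = row_mx D12 0.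
Proof. by rewrite mul_row_block !mulmx0 !mulmx1 !mul0mx !addr0. Qed.

Lemma lift_r_col : lift_r Y V *m col_mx D21 0 = col_mx D21 0.
Proof. by rewrite mul_block_col !mulmx0 !mul1mx !mul0mx !addr0. Qed.

Lemma lmiA_cl : (theta X U)^T *m Acl pl K *m pi_mx Y V = lmiA X Y Z.
Proof.
rewrite AclE mulmxDr mulmxDl /lmiA /Z mulmxDr mulmxDl [RHS]addrCA [LHS]addrC;
  congr (_ + _).
  by rewrite !mulmxA theta_input -!mulmxA output_pi.
rewrite /theta /pi_mx /lift_shift /input_mx tr_block_mx !mulmx_block trmx1 trmx0 trmxK Xs.
by rewrite !mul0mx !mulmx0 !mul1mx !mulmx1 !addr0 !add0r !mul0mx add_block_mx !addr0
  !add0r.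
Qed.

Lemma lmiB_cl : (theta X U)^T *m Bcl pl K = lmiB X Z.
Proof.
rewrite BclE mulmxDr /lmiB /Z mulmxDr mulmxDl [RHS]addrCA [LHS]addrC; congr (_ + _).
  by rewrite !mulmxA theta_input -!mulmxA lift_r_col.
rewrite /theta /lift_shift /input_mx tr_block_mx !mulmx_block !mul_block_col trmx1
  trmx0 trmxK Xs.
by rewrite !mul0mx !mulmx0 !mul1mx !addr0 !mul0mx col_mx0 addr0.
Qed.

Lemma lmiC_cl : Ccl pl K *m pi_mx Y V = lmiC Y Z.
Proof.
rewrite CclE mulmxDl /lmiC /Z mulmxDr mulmxDl [RHS]addrCA [LHS]addrC; congr (_ + _).
  by rewrite !mulmxA row_lift_l -!mulmxA output_pi.
rewrite /pi_mx /lift_shift !mul_row_block.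
by rewrite !mul0mx !mulmx0 !mulmx1 ?addr0 ?add0r ?mul0mx ?row_mx0 ?addr0.
Qed.

Lemma lmiD_cl : Dcl pl K = lmiD Z.
Proof.
rewrite DclE /lmiD /Z mulmxDr mulmxDl; congr (_ + _).
rewrite /lift_shift mul_row_block !mul0mx !mulmx0 !addr0 row_mx0 mul0mx addr0.
by rewrite !mulmxA row_lift_l -!mulmxA lift_r_col.
Qed.

End Lift.

(* Forced by [P *m invmx P = 1], that is, [X Y + U V = 1]. *)
Definition vfac X Y U := invmx U *m (1%:M - X *m Y).

Definition reconstruct X Y U Z : ctrl :=
  invmx (lift_l X U) *m (Z - lift_shift X Y) *m invmx (lift_r Y (vfac X Y U)).

Lemma lift_l_unit X U : U \in unitmx -> lift_l X U \in unitmx.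
Proof. by rewrite !unitmxE det_lblock det1 mul1r. Qed.

Lemma lift_r_unit Y V : V \in unitmx -> lift_r Y V \in unitmx.
Proof. by rewrite !unitmxE det_ublock det1 mul1r. Qed.

(** If X Y v = v, then [gram] annihilates (v, - Y v), so positivity excludes a kernel of 1 - X Y. *)
Lemma vfac_unit X Y U : U \in unitmx -> posdef (gram X Y) -> vfac X Y U \in unitmx.
Proof.
move=> Uu Gp; rewrite unitmx_mul unitmx_inv Uu /=.
apply: contraT => /nonunit_ker[v v0]; rewrite mulmxBl mul1mx => /eqP.
rewrite subr_eq0 => /eqP vE;
  have vY0 : col_mx v (- (Y *m v)) != 0 by rewrite col_mx_eq0 negb_and v0.
have := Gp _ vY0.
by rewrite mul_block_col !mulmxN !mul1mx mulmxA -vE !subrr dotv_col !dotv0r addr0 ltxx.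
Qed.

Lemma pi_mx_unit Y V : V \in unitmx -> pi_mx Y V \in unitmx.
Proof.
move=> Vu; apply: contraT => /nonunit_ker[v]; rewrite -[v]vsubmxK mul_block_col.
rewrite mul1mx mul0mx addr0 col_mx_eq0 => v0.
rewrite -[RHS]col_mx0 => /eq_col_mx[E1 E2]; move: v0.
have a0 : usubmx v = 0 by rewrite -(mulKmx Vu (usubmx v)) E2 mulmx0.
by move: E1; rewrite a0 mulmx0 add0r => ->; rewrite !eqxx.
Qed.

Lemma pi_theta X Y U V : Y^T = Y -> X^T = X -> U *m V = 1%:M - X *m Y ->
  (pi_mx Y V)^T *m theta X U = gram X Y.
Proof.
move=> Ys Xs UV; rewrite /pi_mx tr_block_mx mulmx_block trmx1 trmx0 Ys.
rewrite !mul0mx !mulmx0 !mul1mx !mulmx1 !addr0 -trmx_mul UV.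
by rewrite linearB /= trmx1 trmx_mul Ys Xs addrC subrK.
Qed.

Lemma reconstructK X Y U K : U \in unitmx -> vfac X Y U \in unitmx ->
  reconstruct X Y U (lift_l X U *m K *m lift_r Y (vfac X Y U) + lift_shift X Y) = K.
Proof.
move=> Uu Vu; rewrite /reconstruct addrK -!mulmxA mulKmx ?lift_l_unit //.
by rewrite mulmxV ?mulmx1 // lift_r_unit.
Qed.

Lemma reconstruct_lift X Y U Z : U \in unitmx -> vfac X Y U \in unitmx ->
  lift_l X U *m reconstruct X Y U Z *m lift_r Y (vfac X Y U) + lift_shift X Y = Z.
Proof.
move=> Uu Vu; rewrite /reconstruct -!mulmxA mulVmx ?lift_r_unit // mulmx1.
by rewrite mulmxA mulmxV ?lift_l_unit // mul1mx subrK.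
Qed.

Lemma hinf_normE K : hinf_norm pl K = hinf (Acl pl K) (Bcl pl K) (Ccl pl K) (Dcl pl K).
Proof. by []. Qed.

Lemma reconstruct_Kgamma (g : R) X Y U Z : 0 < g -> U \in unitmx ->
  lmi_feasible g X Y Z -> Kgamma pl g (reconstruct X Y U Z).
Proof.
move=> g0 Uu [Xs Ys Gp diss]; have Vu := vfac_unit Uu Gp.
set K := reconstruct X Y U Z; set V := vfac X Y U in Vu.
have UV : U *m V = 1%:M - X *m Y by rewrite mulKVmx.
have ZE := reconstruct_lift Z Uu Vu; rewrite -/K -/V in ZE.
have Piu := pi_mx_unit Y Vu; set Pi := pi_mx Y V in Piu.
(* The only matrix with P * pi_mx = theta. It is congruent to [gram], which yields symmetry and
   positivity without computing its lower right block. *)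
pose P := theta X U *m invmx Pi.
have PPi : P *m Pi = theta X U by rewrite mulmxKV.
have PE : P = (invmx Pi)^T *m gram X Y *m invmx Pi.
  by rewrite -(pi_theta Ys Xs UV) mulmxA -trmx_mul mulmxV // trmx1 mul1mx.
have Gs : (gram X Y)^T = gram X Y by rewrite tr_block_mx !trmx1 Xs Ys.
have Ps : P^T = P by rewrite PE !trmx_mul Gs trmxK mulmxA.
have Pp : posdef P by rewrite PE; apply: posdef_congr; rewrite // unitmx_inv.
have PiP : Pi^T *m P = (theta X U)^T by rewrite -Ps -trmx_mul PPi.
have {}diss : dissipative g (P *m Acl pl K) (P *m Bcl pl K) (Ccl pl K) (Dcl pl K).
  move: diss; rewrite -ZE -(lmiA_cl Y U V K Xs) -(lmiB_cl Y U V K Xs) -lmiC_cl -lmiD_cl.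
  rewrite -/Pi -PiP -!mulmxA => /(@dissipative_congr _ _ _ _ _ _ _ _ _ (invmx Pi)).
  rewrite unitmx_inv => /(_ Piu).
  by rewrite !mulmxA -trmx_mul mulmxV // trmx1 !mul1mx !mulmxK.
split; first exact: dissipative_hurwitz Ps Pp diss.
by rewrite hinf_normE; exact: dissipative_hinf g0 Ps Pp diss.
Qed.

Lemma dissipative_perturb n (g : R) (M : 'M[R]_n) (N : 'M[R]_(n, nw))
    (C : 'M[R]_(nz, n)) (D : 'M[R]_(nz, nw)) (P E : 'M[R]_n) :
  dissipative g (P *m M) (P *m N) C D -> exists2 e, 0 < e &
  forall t, 0 <= t <= e -> dissipative g ((P + t *: E) *m M) ((P + t *: E) *m N) C D.
Proof.
move=> /dissipativeP h.
have [e e0 eP] := posdef_perturb (block_mx (- 2 *: (E *m M)) (- 2 *: (E *m N)) 0 0) h.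
exists e => // t /eP ht; apply/dissipativeP.
suff -> : dissmx g ((P + t *: E) *m M) ((P + t *: E) *m N) C D =
  dissmx g (P *m M) (P *m N) C D + t *: block_mx (- 2 *: (E *m M)) (- 2 *: (E *m N)) 0
    0 by [].
rewrite /dissmx scale_block_mx add_block_mx !scaler0 !addr0.
rewrite !mulmxDl -!scalemxAl !scalerDr !opprD !addrA !scalerA.
have -> : t * (-1 - 1) = - (2 * t) by ring.
by rewrite !scaleNr.
Qed.

Lemma Kgamma_lift (g : R) K : 0 < g -> Kgamma pl g K ->
  exists X Y U Z, [/\ U \in unitmx, lmi_feasible g X Y Z & K = reconstruct X Y U Z].
Proof.
move=> g0 [hA]; rewrite hinf_normE => /(hinf_dissipative g0 hA)[P0 [P0s P0p diss0]].
(* Adding t E shifts [U] by t times the identity; both strict inequalities survive for small t, and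
   some such t makes [U] invertible. *)
pose E : 'M[R]_(nx + nx) := block_mx 0 1%:M 1%:M 0.
have [e1 e10 h1] := posdef_perturb E P0p.
have [e2 e20 h2] := dissipative_perturb E diss0.
have e0 : 0 < Num.min e1 e2 by rewrite lt_min e10.
have [t /andP[t0 te] tU] := exists_unit_shift (ursubmx P0) e0.
move: te; rewrite le_min => /andP[te1 te2].
pose P := P0 + t *: E.
have Pp : posdef P by apply: h1; rewrite ltW.
have diss : dissipative g (P *m Acl pl K) (P *m Bcl pl K) (Ccl pl K) (Dcl pl K).
  by apply: h2; rewrite ltW.
have Ps : P^T = P.
  by rewrite linearD linearZ /= P0s tr_block_mx !trmx1 !trmx0.
pose X := ulsubmx P; pose U := ursubmx P; pose W := drsubmx P.
have Xs : X^T = X by rewrite trmx_ulsub Ps.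
have UT : dlsubmx P = U^T by rewrite trmx_ursub Ps.
have UE : U = ursubmx P0 + t%:M.
  by rewrite /U /P -[P0 in LHS]submxK scale_block_mx add_block_mx block_mxKur scalemx1.
have Uu : U \in unitmx by rewrite UE.
have PE : P = block_mx X U U^T W by rewrite -UT submxK.
pose Q := invmx P; have Pu := posdef_unit Pp.
have Qs : Q^T = Q by rewrite trmx_inv Ps.
pose Y := ulsubmx Q; pose V := dlsubmx Q.
have Ys : Y^T = Y by rewrite trmx_ulsub Qs.
have [E1 E2] : X *m Y + U *m V = 1%:M /\ U^T *m Y + W *m V = 0.
  have := mulmxV Pu; rewrite -/Q PE -[Q]submxK mulmx_block -/Y -/V.
  by rewrite scalar_mx_block => /eq_block_mx[].
have UV : U *m V = 1%:M - X *m Y by rewrite -E1 addrC addKr.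
have VE : V = vfac X Y U by rewrite /vfac -UV mulKmx.
have PPi : P *m pi_mx Y V = theta X U.
  by rewrite PE mulmx_block !mulmx1 !mulmx0 !addr0 E1 E2.
have Piu : pi_mx Y V \in unitmx.
  have : theta X U \in unitmx by rewrite unitmxE det_ublock det1 mul1r -unitmxE unitmx_tr.
  by rewrite -PPi unitmx_mul => /andP[].
have PiP : (pi_mx Y V)^T *m P = (theta X U)^T by rewrite -{1}Ps -trmx_mul PPi.
have Gp : posdef (gram X Y).
  by rewrite -(pi_theta Ys Xs UV) -PPi mulmxA; exact: posdef_congr.
exists X, Y, U, (lift_l X U *m K *m lift_r Y V + lift_shift X Y).
have Vu : vfac X Y U \in unitmx by exact: vfac_unit.
split => //; last by rewrite VE reconstructK.
split => //; rewrite -(lmiA_cl Y U V K Xs) -(lmiB_cl Y U V K Xs) -lmiC_cl -lmiD_cl.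
by rewrite -PiP -!mulmxA; move: (dissipative_congr Piu diss); rewrite !mulmxA.
Qed.

End ChangeOfVariables.

(** * Paths in the general linear group *)

Section GLPath.
Variable R : realType.

(** Freezing paths outside [0, 1] makes them total, continuous and invertible on the whole line, so
    the continuity lemmas apply without restricting the domain. *)
Definition clamp (t : R) : R := Num.max 0 (Num.min 1 t).

Lemma clamp_itv t : 0 <= clamp t <= 1.
Proof. by rewrite /clamp le_max lexx ge_max ler01 ge_min lexx. Qed.

Lemma clamp_le0 t : t <= 0 -> clamp t = 0.
Proof. by move=> t0; rewrite /clamp max_l // ge_min t0 orbT. Qed.

Lemma clamp_ge1 t : 1 <= t -> clamp t = 1.
Proof. by move=> t1; rewrite /clamp min_l // max_r. Qed.

Lemma continuous_clamp : continuous clamp.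
Proof.
move=> t; apply: (@continuous_max R R (fun=> 0) ((fun=> 1) \min id) t).
  exact: cst_continuous.
apply: (@continuous_min R R (fun=> 1) id t); first exact: cst_continuous.
exact: cvg_id.
Qed.

Lemma continuous_affine (a b : R) : continuous (fun t : R => a * t + b).
Proof.
move=> t; apply: cvgD; last exact: cvg_cst.
by apply: cvgM; [exact: cvg_cst | exact: cvg_id].
Qed.

Definition gl_path n (A B : 'M[R]_n) := exists f : R -> 'M[R]_n,
  [/\ entry_cont f, f 0 = A, f 1 = B & forall t, f t \in unitmx].

Lemma entry_cont_comp m n (f : R -> 'M[R]_(m, n)) (h : R -> R) :
  continuous h -> entry_cont f -> entry_cont (fun t => f (h t)).
Proof.
move=> hc fc i j t; apply: (@continuous_comp _ _ _ h (fun u => f u i j)).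
  exact: hc.
exact: fc.
Qed.

Lemma gl_path_segment n (A E : 'M[R]_n) :
  (forall t, 0 <= t <= 1 -> A + t *: E \in unitmx) -> gl_path A (A + E).
Proof.
move=> h; exists (fun t => A + clamp t *: E); split.
- apply: entry_contD; first exact: entry_cont_cst.
  by apply: entry_contZ; [exact: continuous_clamp | exact: entry_cont_cst].
- by rewrite clamp_le0 // scale0r addr0.
- by rewrite clamp_ge1 // scale1r.
- by move=> t; apply: h; exact: clamp_itv.
Qed.

Lemma gl_path_sym n (A B : 'M[R]_n) : gl_path A B -> gl_path B A.
Proof.
case=> f [fc f0 f1 fu]; exists (fun t => f (-1 * t + 1)); split.
- by apply: entry_cont_comp => //; exact: continuous_affine.
- by rewrite mulr0 add0r.
- by rewrite mulr1 addNr.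
- by [].
Qed.

Lemma gl_path_trans n (A B C : 'M[R]_n) : gl_path A B -> gl_path B C -> gl_path A C.
Proof.
case=> f [fc f0 f1 fu] [h [hc h0 h1 hu]].
pose a (t : R) := clamp (2 * t + 0); pose b (t : R) := clamp (2 * t - 1).
have clampc (u v : R) : continuous (fun t : R => clamp (u * t + v)).
  move=> t; apply: (@continuous_comp _ _ _ (fun t : R => u * t + v) clamp).
    exact: continuous_affine.
  exact: continuous_clamp.
(* One of the two terms is always at rest, at [B]. *)
exists (fun t => f (a t) + (h (b t) - B)); split.
- apply: entry_contD; first exact: (entry_cont_comp (clampc 2 0) fc).
  apply: entry_contD; last exact: entry_cont_cst.
  exact: (entry_cont_comp (clampc 2 (- 1)) hc).
- by rewrite /a /b !clamp_le0 ?f0 ?h0 ?subrr ?addr0 //; lra.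
- by rewrite /a /b !clamp_ge1 ?f1 ?h1 //; first rewrite addrCA subrr addr0 //; lra.
move=> t; have [t2|t2] := leP (2 * t) 1.
  by rewrite /b clamp_le0 ?h0 ?subrr ?addr0 //; lra.
by rewrite /a clamp_ge1 ?f1; [rewrite addrCA subrr addr0 | rewrite addr0; exact: ltW].
Qed.

Lemma gl_pathMl n (A B M : 'M[R]_n) : M \in unitmx -> gl_path A B ->
  gl_path (M *m A) (M *m B).
Proof.
move=> Mu [f [fc f0 f1 fu]]; exists (fun t => M *m f t); split.
- by apply: entry_contM => //; exact: entry_cont_cst.
- by rewrite f0.
- by rewrite f1.
- by move=> t; rewrite unitmx_mul Mu fu.
Qed.

Lemma gl_path_nilp_l n (A N : 'M[R]_n) : A \in unitmx ->
  (forall t, 1%:M + t *: N \in unitmx) -> gl_path A ((1%:M + N) *m A).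
Proof.
move=> Au h; rewrite mulmxDl mul1mx; apply: gl_path_segment => t _.
rewrite (_ : A + t *: (N *m A) = (1%:M + t *: N) *m A) ?unitmx_mul ?h //.
by rewrite mulmxDl mul1mx scalemxAl.
Qed.

Lemma gl_path_nilp_r n (A N : 'M[R]_n) : A \in unitmx ->
  (forall t, 1%:M + t *: N \in unitmx) -> gl_path A (A *m (1%:M + N)).
Proof.
move=> Au h; rewrite mulmxDr mulmx1; apply: gl_path_segment => t _.
rewrite (_ : A + t *: (A *m N) = A *m (1%:M + t *: N)) ?unitmx_mul ?h ?Au //.
by rewrite mulmxDr mulmx1 scalemxAr.
Qed.

Lemma block_unip_u m n (r : 'M[R]_(m, n)) t :
  1%:M + t *: block_mx 0 r 0 0 = block_mx 1%:M (t *: r) 0 1%:M :> 'M[R]_(m + n).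
Proof. by rewrite scalar_mx_block scale_block_mx add_block_mx !scaler0 !addr0 add0r. Qed.

Lemma block_unip_l m n (c : 'M[R]_(n, m)) t :
  1%:M + t *: block_mx 0 0 c 0 = block_mx 1%:M 0 (t *: c) 1%:M :> 'M[R]_(m + n).
Proof. by rewrite scalar_mx_block scale_block_mx add_block_mx !scaler0 !addr0 add0r. Qed.

Lemma gl_path_unip_u m n (A : 'M[R]_(m + n)) (r : 'M[R]_(m, n)) : A \in unitmx ->
  gl_path A (block_mx 1%:M r 0 1%:M *m A).
Proof.
move=> Au; have := block_unip_u r 1; rewrite !scale1r => <-.
apply: gl_path_nilp_l => // t.
by rewrite block_unip_u unitmxE det_ublock !det1 mulr1 unitr1.
Qed.

Lemma gl_path_unip_l m n (A : 'M[R]_(m + n)) (r : 'M[R]_(n, m)) : A \in unitmx ->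
  gl_path A (block_mx 1%:M 0 r 1%:M *m A).
Proof.
move=> Au; have := block_unip_l r 1; rewrite !scale1r => <-.
apply: gl_path_nilp_l => // t.
by rewrite block_unip_l unitmxE det_lblock !det1 mulr1 unitr1.
Qed.

Lemma gl_path_unip_lr m n (A : 'M[R]_(m + n)) (r : 'M[R]_(n, m)) : A \in unitmx ->
  gl_path A (A *m block_mx 1%:M 0 r 1%:M).
Proof.
move=> Au; have := block_unip_l r 1; rewrite !scale1r => <-.
apply: gl_path_nilp_r => // t.
by rewrite block_unip_l unitmxE det_lblock !det1 mulr1 unitr1.
Qed.

Lemma gl_path_block m n (A A' : 'M[R]_m) (D D' : 'M[R]_n) :
  gl_path A A' -> gl_path D D' -> gl_path (block_mx A 0 0 D) (block_mx A' 0 0 D').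
Proof.
case=> f [fc f0 f1 fu] [h [hc h0 h1 hu]].
exists (fun t => block_mx (f t) 0 0 (h t)); split; rewrite ?f0 ?f1 ?h0 ?h1 //.
  by apply: entry_cont_block => //; exact: entry_cont_cst.
by move=> t; rewrite unitmxE det_ublock unitrM -!unitmxE fu hu.
Qed.

(** Block elimination multiplies by shears only; scaling their off-diagonal block joins them to 1 at
    constant determinant 1. *)
Lemma gl_path_schur m n (a : 'M[R]_m) r c (D : 'M[R]_n) :
  block_mx a r c D \in unitmx -> D \in unitmx ->
  gl_path (block_mx a r c D) (block_mx (a - r *m invmx D *m c) 0 0 D) /\
  \det (block_mx a r c D) = \det (a - r *m invmx D *m c) * \det D.
Proof.
move=> Mu Du; set M := block_mx a r c D.
pose L := block_mx 1%:M (- (r *m invmx D)) 0 1%:M : 'M[R]_(m + n).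
pose T := block_mx 1%:M 0 (- (invmx D *m c)) 1%:M : 'M[R]_(m + n).
have LME : L *m M *m T = block_mx (a - r *m invmx D *m c) 0 0 D.
  rewrite !mulmx_block !mul1mx !mul0mx !mulmx0 !mulmx1 !add0r !mulNmx mulmxKV // subrr.
  by rewrite mul0mx addr0 mulmxN mulmxA mulmxV // mul1mx subrr.
have L1 : \det L = 1 by rewrite det_ublock !det1 mulr1.
have T1 : \det T = 1 by rewrite det_lblock !det1 mulr1.
split; last by rewrite -(det_ublock _ 0) -LME !det_mulmx L1 T1 mul1r mulr1.
rewrite -LME; apply: gl_path_trans (gl_path_unip_u _ Mu) _.
by apply: gl_path_unip_lr; rewrite unitmx_mul Mu unitmxE L1 unitr1.
Qed.

Lemma det_gt0_unit n (A : 'M[R]_n) : 0 < \det A -> A \in unitmx.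
Proof. by move=> A0; rewrite unitmxE unitfE gt_eqF. Qed.

Lemma gl_path_scalar1 (a : 'M[R]_1) : 0 < \det a -> gl_path a 1%:M.
Proof.
rewrite det_mx11 => a0; rewrite (_ : 1%:M = a + (1%:M - a)); last by rewrite addrC subrK.
apply: gl_path_segment => t /andP[t0 t1]; apply: det_gt0_unit;
  rewrite det_mx11 !mxE eqxx mulr1n.
rewrite (_ : _ + _ = (1 - t) * a 0 0 + t); last by ring.
have [t1'|t1'] := eqVneq t 1; first by rewrite t1' subrr mul0r add0r.
by rewrite ltr_pwDl // mulr_gt0 // subr_gt0 lt_neqAle t1' t1.
Qed.

Lemma det_shift_gt0 n (A E : 'M[R]_n) : 0 < \det A ->
  exists2 e, 0 < e & forall t, 0 <= t <= e -> 0 < \det (A + t *: E).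
Proof.
move=> A0; pose d t : R := \det (A + t *: E).
have dc : continuous d.
  apply: continuous_det; apply: entry_contD; first exact: entry_cont_cst.
  by apply: entry_contZ; [move=> t; exact: cvg_id | exact: entry_cont_cst].
have d0 : 0 < d 0 by rewrite /d scale0r addr0.
have /nbhs_ballP[e /= e0 eP] : \forall t \near (0 : R), 0 < d t.
  apply: (dc 0 [set x : R | 0 < x]); apply: open_nbhs_nbhs.
  by split; [exact: open_gt | exact: d0].
exists (e / 2) => [|t /andP[t0 te]]; first by rewrite divr_gt0.
apply: eP; rewrite /ball /= sub0r normrN ger0_norm //; lra.
Qed.

(** Induction through the Schur complement, which splits off a scalar. It needs a lower right block
    of positive determinant: a small shift makes that block invertible, a reflection corrects its
    sign. *)
Lemma gl_path_det_gt0 n (A : 'M[R]_n) : 0 < \det A -> gl_path A 1%:M.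
Proof.
elim: n A => [A _|n IH].
  rewrite [A]flatmx0 [1%:M]flatmx0 -[X in gl_path _ X](addr0 (0 : 'M[R]_0)).
  by apply: gl_path_segment => t _; rewrite unitmxE det_mx00 unitr1.
rewrite -[n.+1]/(1 + n)%N.
have posD (a : 'M[R]_1) r c (D : 'M[R]_n) : 0 < \det (block_mx a r c D) ->
    0 < \det D -> gl_path (block_mx a r c D) 1%:M.
  move=> A0 D0; have [p d] := gl_path_schur (det_gt0_unit A0) (det_gt0_unit D0).
  apply: gl_path_trans p _; rewrite scalar_mx_block; apply: gl_path_block; last exact: IH.
  by apply: gl_path_scalar1; move: A0; rewrite d pmulr_lgt0.
(* When [\det D < 0], adding a multiple of the first row reflects one row of [D]. *)
have unitD (a : 'M[R]_1) r c (D : 'M[R]_n) : 0 < \det (block_mx a r c D) ->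
    D \in unitmx -> gl_path (block_mx a r c D) 1%:M.
  move=> A0 Du; have [D0|] := ltP 0 (\det D); first exact: posD.
  rewrite le_eqVlt => /predU1P[D0|D0].
    by move: Du; rewrite unitmxE D0 unitr0.
  have [p d] := gl_path_schur (det_gt0_unit A0) Du.
  apply: gl_path_trans p _; set s := a - _ in d *.
  clearbody s; rewrite {}d in A0;
    case: n {IH} posD D {r c} Du D0 A0 => [|n] posD D Du D0 A0.
    by move: D0; rewrite det_mx00 ltr10.
  (* Shearing by [v] and then by - 2 v^T turns [D] into D - 2 v^T v D = J D, where [J] negates the
     first coordinate and has determinant -1. *)
  pose v : 'rV[R]_n.+1 := delta_mx 0 0.
  pose J : 'M[R]_n.+1 := 1%:M - 2 *: (v^T *m v).
  have JE : J = diag_mx (\row_i (if i == 0 then -1 else 1)).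
    rewrite /J /v trmx_delta mul_delta_mx; apply/matrixP => i j; rewrite !mxE.
    have [->|i0] := eqVneq i 0; last by rewrite mulr0 subr0.
    by rewrite eq_sym; case: (j == 0); rewrite /= ?mulr1n ?mulr0n; ring.
  have Jd : \det J = -1.
    rewrite JE det_diag (bigD1 0) //= big1 => [|i i0]; rewrite mxE ?eqxx ?mulr1 //.
    by rewrite (negPf i0).
  have Mu : block_mx s 0 0 D \in unitmx by apply: det_gt0_unit; rewrite det_ublock.
  apply: gl_path_trans (gl_path_unip_u v Mu) _.
  set M1 := _ *m _; have M1d : \det M1 = \det s * \det D.
    by rewrite det_mulmx !det_ublock !det1 !mul1r.
  have M1u : M1 \in unitmx by apply: det_gt0_unit; rewrite M1d.
  apply: gl_path_trans (gl_path_unip_l (- 2 *: v^T) M1u) _.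
  have : 0 < \det (block_mx 1%:M 0 (- 2 *: v^T) 1%:M *m M1).
    by rewrite det_mulmx det_lblock !det1 !mul1r M1d.
  rewrite /M1 !mulmx_block !mul1mx !mul0mx !mulmx0 !addr0 !add0r => M2d.
  apply: posD => //; rewrite (_ : _ + _ = J *m D); last first.
    by rewrite /J mulmxBl mul1mx addrC scaleNr mulNmx mulmxA -!scalemxAl.
  by rewrite det_mulmx Jd mulN1r oppr_gt0.
(* The lower right block may be singular; it is shifted by a small [t] along a segment on which the
   full determinant stays positive. *)
move=> A A0; have [e e0 eP] := det_shift_gt0 (block_mx 0 0 0 1%:M : 'M[R]_(1 + n)) A0.
have [t /andP[t0 te] tu] := exists_unit_shift (drsubmx (A : 'M[R]_(1 + n))) e0.
apply: gl_path_trans.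
  apply: (@gl_path_segment _ A (t *: block_mx 0 0 0 1%:M)) => u /andP[u0 u1].
  apply: det_gt0_unit; rewrite scalerA; apply: eP.
  apply/andP; split; first by rewrite mulr_ge0 // ltW.
  by apply: le_trans te; rewrite ler_piMl // ltW.
have := eP t; rewrite (ltW t0) te => /(_ isT).
rewrite -[A]submxK scale_block_mx add_block_mx => d0.
by apply: unitD => //; rewrite scalemx1.
Qed.

End GLPath.

(** * Convexity of the transformed inequality *)

Section Convexity.
Variable R : realType.

Definition comb m n (t : R) (A B : 'M[R]_(m, n)) := (1 - t) *: A + t *: B.

Lemma combM_l m n p t (M : 'M[R]_(m, n)) (A B : 'M[R]_(n, p)) :
  M *m comb t A B = comb t (M *m A) (M *m B).
Proof. by rewrite mulmxDr -!scalemxAr. Qed.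

Lemma combM_r m n p t (A B : 'M[R]_(m, n)) (M : 'M[R]_(n, p)) :
  comb t A B *m M = comb t (A *m M) (B *m M).
Proof. by rewrite mulmxDl -!scalemxAl. Qed.

Lemma combD m n t (A B C D : 'M[R]_(m, n)) :
  comb t A B + comb t C D = comb t (A + C) (B + D).
Proof. by rewrite /comb !scalerDr addrACA. Qed.

Lemma combxx m n t (A : 'M[R]_(m, n)) : comb t A A = A.
Proof. by rewrite /comb -scalerDl subrK scale1r. Qed.

Lemma comb0 m n (A B : 'M[R]_(m, n)) : comb 0 A B = A.
Proof. by rewrite /comb subr0 scale1r scale0r addr0. Qed.

Lemma comb1 m n (A B : 'M[R]_(m, n)) : comb 1 A B = B.
Proof. by rewrite /comb subrr scale1r scale0r add0r. Qed.

Lemma comb_tr m n t (A B : 'M[R]_(m, n)) : (comb t A B)^T = comb t A^T B^T.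
Proof. by rewrite linearD !linearZ. Qed.

Lemma comb_block m1 m2 n1 n2 t (A A' : 'M[R]_(m1, n1)) (B B' : 'M[R]_(m1, n2))
    (C C' : 'M[R]_(m2, n1)) (D D' : 'M[R]_(m2, n2)) :
  block_mx (comb t A A') (comb t B B') (comb t C C') (comb t D D') =
  comb t (block_mx A B C D) (block_mx A' B' C' D').
Proof. by rewrite /comb !scale_block_mx add_block_mx. Qed.

Lemma comb_col m1 m2 n t (A A' : 'M[R]_(m1, n)) (B B' : 'M[R]_(m2, n)) :
  col_mx (comb t A A') (comb t B B') = comb t (col_mx A B) (col_mx A' B').
Proof. by rewrite /comb !scale_col_mx add_col_mx. Qed.

Lemma comb_row m n1 n2 t (A A' : 'M[R]_(m, n1)) (B B' : 'M[R]_(m, n2)) :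
  row_mx (comb t A A') (comb t B B') = comb t (row_mx A B) (row_mx A' B').
Proof. by rewrite /comb !scale_row_mx add_row_mx. Qed.

Lemma convex_gt0 (t a b : R) : 0 <= t <= 1 -> 0 < a -> 0 < b -> 0 < (1 - t) * a + t * b.
Proof.
move=> /andP[t0 t1] a0 b0; have [->|t0'] := eqVneq t 0.
  by rewrite subr0 mul1r mul0r addr0.
by rewrite ltr_wpDl // ?mulr_gt0 ?mulr_ge0 ?subr_ge0 ?(ltW a0) // lt0r t0'.
Qed.

Lemma posdef_comb n t (A B : 'M[R]_n) : 0 <= t <= 1 -> posdef A -> posdef B ->
  posdef (comb t A B).
Proof.
move=> ht Ap Bp x x0; rewrite combM_r !dotvE.
by apply: convex_gt0; [|exact: Ap|exact: Bp].
Qed.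

Lemma dotv_convex n t (x y : 'cV[R]_n) : 0 <= t <= 1 ->
  dotv (comb t x y) (comb t x y) <= (1 - t) * dotv x x + t * dotv y y.
Proof.
move=> /andP[t0 t1]; have t1' : 0 <= 1 - t by rewrite subr_ge0.
have := mulr_ge0 (mulr_ge0 t0 t1') (dotv_ge0 (x - y)).
rewrite !dotvE (dotvC y x) => h; rewrite -subr_ge0; apply: le_trans h _.
by rewrite le_eqVlt; apply/orP; left; apply/eqP; ring.
Qed.

(** The inequality is affine in [A] and [B] but quadratic in [C] and [D]. The square enters with a
    minus sign, so its convexity helps and no Schur complement is required. *)
Lemma dissipative_comb n nw nz (g t : R) (A A' : 'M[R]_n) (B B' : 'M[R]_(n, nw))
    (C C' : 'M[R]_(nz, n)) (D D' : 'M[R]_(nz, nw)) : 0 <= t <= 1 ->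
  dissipative g A B C D -> dissipative g A' B' C' D' ->
  dissipative g (comb t A A') (comb t B B') (comb t C C') (comb t D D').
Proof.
move=> ht h h' x w xw; rewrite !combM_r !combD.
apply: lt_le_trans (convex_gt0 ht (h x w xw) (h' x w xw)) _.
have := dotv_convex (C *m x + D *m w) (C' *m x + D' *m w) ht.
rewrite [dotv x (comb _ _ _)]dotvDr !dotvZr.
move: (dotv w w) (dotv (comb _ _ _) _) (dotv (C *m x + _) _) (dotv (C' *m x + _) _).
move: (dotv x _) (dotv x _) => p q a b c d; rewrite -subr_ge0 => hb.
rewrite -subr_ge0; apply: le_trans hb _.
by rewrite le_eqVlt; apply/orP; left; apply/eqP; ring.
Qed.

Lemma entry_cont_comb (T : topologicalType) m n (k : T -> R) (A B : 'M[R]_(m, n)) :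
  continuous k -> entry_cont (fun t => comb (k t) A B).
Proof.
move=> kc; apply: entry_contD; apply: entry_contZ => //; try exact: entry_cont_cst.
move=> t; apply: cvgB; [exact: cvg_cst | exact: kc].
Qed.

Variables (nx nw nu ny nz : nat) (pl : plant R nx nw nu ny nz).

Lemma lmi_feasible_comb (g t : R) (X X' Y Y' : 'M[R]_nx) (Z Z' : 'M[R]_(nu + nx, ny +
  nx)) :
  0 <= t <= 1 -> lmi_feasible pl g X Y Z -> lmi_feasible pl g X' Y' Z' ->
  lmi_feasible pl g (comb t X X') (comb t Y Y') (comb t Z Z').
Proof.
move=> ht [Xs Ys Gp h] [Xs' Ys' Gp' h']; split.
- by rewrite comb_tr Xs Xs'.
- by rewrite comb_tr Ys Ys'.
- rewrite /gram -[1%:M](combxx t) comb_block; exact: posdef_comb.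
have -> : lmiA pl (comb t X X') (comb t Y Y') (comb t Z Z') =
    comb t (lmiA pl X Y Z) (lmiA pl X' Y' Z').
  by rewrite /lmiA -combD -comb_block !combxx -!combM_r -!combM_l.
have -> : lmiB pl (comb t X X') (comb t Z Z') = comb t (lmiB pl X Z) (lmiB pl X' Z').
  by rewrite /lmiB -combD -comb_col !combxx -!combM_r -!combM_l.
have -> : lmiC pl (comb t Y Y') (comb t Z Z') = comb t (lmiC pl Y Z) (lmiC pl Y' Z').
  by rewrite /lmiC -combD -comb_row !combxx -!combM_r -!combM_l.
have -> : lmiD pl (comb t Z Z') = comb t (lmiD pl Z) (lmiD pl Z').
  by rewrite /lmiD -combD !combxx -!combM_r -!combM_l.
exact: dissipative_comb.
Qed.

(** The segment in (X, Y, Z) and the path in [U] run simultaneously. Positivity of [gram] along the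
    segment keeps [vfac] invertible, so the reconstructed controller varies continuously. *)
Lemma path_joined_reconstruct (g : R) (X X' Y Y' U U' : 'M[R]_nx)
    (Z Z' : 'M[R]_(nu + nx, ny + nx)) : 0 < g ->
  lmi_feasible pl g X Y Z -> lmi_feasible pl g X' Y' Z' -> gl_path U U' ->
  path_joined (Kgamma pl g) (reconstruct pl X Y U Z) (reconstruct pl X' Y' U' Z').
Proof.
move=> g0 h h' [u [uc u0 u1 uu]].
pose f t := reconstruct pl (comb (clamp t) X X') (comb (clamp t) Y Y') (u t)
  (comb (clamp t) Z Z').
have feas t := lmi_feasible_comb (clamp_itv t) h h'.
have combc m n (A B : 'M[R]_(m, n)) : entry_cont (fun t => comb (clamp t) A B).
  by apply: entry_cont_comb; exact: continuous_clamp.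
have cst m n (A : 'M[R]_(m, n)) : entry_cont (fun _ : R => A).
  exact: entry_cont_cst.
exists f; split.
  apply: continuous_subspaceT; apply: continuous_mx.
  have vc : entry_cont (fun t => vfac (comb (clamp t) X X') (comb (clamp t) Y Y') (u t)).
    apply: entry_contM; first exact: entry_contV.
    apply: entry_contD; first exact: cst.
    by apply: entry_contN; apply: entry_contM.
  apply: entry_contM; first apply: entry_contM.
  - apply: entry_contV => [t|]; first exact: lift_l_unit.
    by apply: entry_cont_block => //; apply: entry_contM.
  - apply: entry_contD => //; apply: entry_contN; apply: entry_cont_block => //.
    by apply: entry_contM => //; apply: entry_contM.
  - apply: entry_contV => [t|].
      by apply: lift_r_unit; apply: vfac_unit; [exact: uu | case: (feas t)].
    by apply: entry_cont_block => //; apply: entry_contM.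
split; first by rewrite /f clamp_le0 // !comb0 u0.
split; first by rewrite /f clamp_ge1 // !comb1 u1.
by move=> t _; apply: reconstruct_Kgamma => //; exact: feas.
Qed.

(** Left translation by [U] reduces the claim to U^-1 V, of positive determinant. *)
Lemma gl_path_same_sign n (U V : 'M[R]_n) : 0 < \det U * \det V -> gl_path U V.
Proof.
move=> UV; have U0 : \det U != 0 by apply: contraTneq UV => ->; rewrite mul0r ltxx.
have Uu : U \in unitmx by rewrite unitmxE unitfE.
apply: gl_path_sym; rewrite -[X in gl_path _ X]mulmx1 -(mulKVmx Uu V).
apply: gl_pathMl => //; apply: gl_path_det_gt0.
rewrite det_mulmx det_inv -(pmulr_rgt0 _ (_ : 0 < \det U ^+ 2)) ?exprn_even_gt0 ?U0 //.
by rewrite mulrA expr2 mulfK.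
Qed.

End Convexity.

Theorem theorem1 (R : realType) (nx nw nu ny nz : nat)
    (P : plant R nx nw nu ny nz) :
  stabilizable P -> detectable P ->
  forall g : R, 0 < g -> (gamma_star P < g%:E)%E ->
  at_most_two_path_components (Kgamma P g).
Proof.
move=> _ _ g g0 _ a b c /(Kgamma_lift g0)[Xa [Ya [Ua [Za [Uau fa ->]]]]].
move=> /(Kgamma_lift g0)[Xb [Yb [Ub [Zb [Ubu fb ->]]]]].
move=> /(Kgamma_lift g0)[Xc [Yc [Uc [Zc [Ucu fc ->]]]]].
have join := path_joined_reconstruct g0.
have [//|ab] := pselect (0 < \det Ua * \det Ub).
  by left; apply: join => //; exact: gl_path_same_sign.
have [//|ac] := pselect (0 < \det Ua * \det Uc).
  by right; left; apply: join => //; exact: gl_path_same_sign.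
right; right; apply: join => //; apply: gl_path_same_sign.
(* Of three nonzero reals two share a sign: if the last two both disagree with the first, they agree
   with each other. *)
move: Uau Ubu Ucu ab ac; rewrite !unitmxE !unitfE.
move: (\det Ua) (\det Ub) (\det Uc) => x y z x0 y0 z0 /negP + /negP.
rewrite -!leNgt; have [xp|xn|xe] := ltgtP x 0; last by rewrite xe eqxx in x0.
- rewrite !nmulr_rle0 // => y0' z0'.
  by rewrite mulr_gt0 // lt0r ?y0 ?z0.
- rewrite !pmulr_rle0 // => y0' z0'.
  by rewrite nmulr_rgt0 lt_neqAle ?y0 ?z0.
Qed.
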